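(* Let $\frac{5\pi}{12}<\alpha\le\frac{\pi}{2}$, let $R^{\alpha}$ be a rhombus with side length $1$ and with an interior angle $\alpha$, let $\triangle$ be an equilateral triangle with a side parallel to a side (the base) of $R^{\alpha}$, and let $\{\triangle_n\}$ be a collection of homothetic copies of $\triangle$. If $$\sum A(\triangle_n)\ \ge\ \frac{\sqrt3}{4}\Big(1+\frac{2\sqrt3}{3}\sin\alpha\Big)^2,$$ then $\{\triangle_n\}$ permits a parallel covering of $R^{\alpha}$. Moreover, $$\varrho(R^{\alpha},\triangle)=\frac{\sqrt3\,(\sqrt3+2\sin\alpha)^2}{12\sin\alpha}.$$
   Context: $A(P)$ denotes the area of a planar convex body $P$. A collection $\{\triangle_n\}$ ($n=1,2,\ldots$) may be finite or infinite. Admissible rigid motions are translations and rotations of the plane (and their compositions). A collection $\{C_n\}$ of convex polygons permits a covering of a convex polygon $P$ if there exist admissible rigid motions $\sigma_n$, one for each $n$, such that $P\subseteq\bigcup_n\sigma_nC_n$. The covering is called parallel if there exists a side of $P$ (called a base of $P$) such that each $\sigma_nC_n$ has a side parallel to it. $\varrho(R^{\alpha},\triangle)$ is the smallest positive number such that any collection of homothetic copies of $\triangle$ with total area not less than $\varrho(R^{\alpha},\triangle)\cdot A(R^{\alpha})$ permits a parallel covering of $R^{\alpha}$. *)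

(* Defs.v *)
From HB Require Import structures.
From mathcomp Require Import all_boot all_order all_algebra.
From mathcomp Require Import all_classical all_reals all_analysis.
Set Implicit Arguments.
Unset Strict Implicit.
Unset Printing Implicit Defensive.
Import Order.TTheory GRing.Theory Num.Theory numFieldNormedType.Exports.
Local Open Scope classical_set_scope.
Local Open Scope ring_scope.

Section Plane.
Variable R : realType.

Implicit Types (x y u : R * R) (P T C : set (R * R)).

Definition dot x y : R := x.1 * y.1 + x.2 * y.2.

(* The library's norm on R * R is the max norm, hence a separate Euclidean
   length. *)
Definition elength x : R := Num.sqrt (dot x x).

(* The angle at the vertex a between the rays ab and ad. *)
Definition angle (b a d : R * R) : R :=
  acos (dot (b - a) (d - a) / (elength (b - a) * elength (d - a))).

Definition parallel x y : Prop := x.1 * y.2 = x.2 * y.1.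

Definition area P : \bar R := (lebesgue_measure \x lebesgue_measure)%E P.

Definition hull P : set (R * R) := smallest (@convex_set R (R * R)%type) P.

(* [p, q] is a side of the convex polygon P: a nondegenerate segment cut out
   of P by a supporting line { x | dot u x = c }. *)
Definition is_side P (p q : R * R) : Prop :=
  p <> q /\
  exists (u : R * R) (c : R),
    [/\ u <> 0,
        forall x, P x -> dot u x <= c &
        P `&` [set x | dot u x = c] = hull [set p; q]].

Definition equilateral_triangle T : Prop :=
  exists a b c : R * R,
    [/\ 0 < elength (b - a),
        elength (c - b) = elength (b - a),
        elength (a - c) = elength (b - a) &
        T = hull [set a; b; c]].

(* Rhombus abcd: a parallelogram all of whose sides have length s.  The vertices
   are labelled so that alpha is the interior angle at a.  Nondegenerate as soon
   as 0 < s and 0 < alpha < pi. *)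
Definition rhombus (s alpha : R) P : Prop :=
  exists a b c d : R * R,
    [/\ b - a = c - d,
        [/\ elength (b - a) = s, elength (c - b) = s,
            elength (d - c) = s & elength (a - d) = s],
        angle b a d = alpha &
        P = hull [set a; b; c; d]].

Definition translation (v : R * R) (x : R * R) : R * R := x + v.

Definition rotation (o : R * R) (theta : R) (x : R * R) : R * R :=
  (o.1 + cos theta * (x.1 - o.1) - sin theta * (x.2 - o.2),
   o.2 + sin theta * (x.1 - o.1) + cos theta * (x.2 - o.2)).

Inductive rigid_motion : (R * R -> R * R) -> Prop :=
| RigidTranslation v : rigid_motion (translation v)
| RigidRotation o theta : rigid_motion (rotation o theta)
| RigidComp f g : rigid_motion f -> rigid_motion g -> rigid_motion (f \o g).

(* The sign of the ratio k is immaterial for coverings: the half-turn is an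
   admissible rigid motion. *)
Definition homothetic_copy T C : Prop :=
  exists (k : R) (v : R * R), k != 0 /\ C = [set k *: x + v | x in T].

(* A finite or infinite collection is a family C restricted to an arbitrary
   set I of indices in nat. *)
Definition permits_parallel_covering (I : set nat) (C : nat -> set (R * R)) P :
    Prop :=
  exists sigma : nat -> R * R -> R * R,
    [/\ forall n, I n -> rigid_motion (sigma n),
        P `<=` \bigcup_(n in I) (sigma n @` C n) &
        exists p q : R * R, is_side P p q /\
          forall n, I n -> exists r s : R * R,
            is_side (sigma n @` C n) r s /\ parallel (s - r) (q - p)].

Definition total_area (I : set nat) (C : nat -> set (R * R)) : \bar R :=
  (\esum_(n in I) area (C n))%E.

Definition covering_factor P T (r : R) : Prop :=
  0 < r /\
  forall (I : set nat) (C : nat -> set (R * R)),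
    (forall n, I n -> homothetic_copy T (C n)) ->
    (r%:E * area P <= total_area I C)%E ->
    permits_parallel_covering I C P.

(* is_rho P T r means varrho(P, T) = r: the smallest covering factor exists and
   equals r. *)
Definition is_rho P T (r : R) : Prop :=
  covering_factor P T r /\ forall r', covering_factor P T r' -> r <= r'.

End Plane.

(* Main.v *)
(* Let H = 2 sin(alpha) / sqrt 3. A triangle of side a with a side parallel to a
   base of the rhombus contains it only if 1 + H <= a, and the threshold on the
   total area is that of the triangle of side 1 + H; this gives the lower bound
   on rho. For the covering, take oblique coordinates along two sides of the
   triangle: the rhombus becomes a parallelogram of base 1 and height H, and the
   hypothesis reads sum a_i ^ 2 >= (1 + H) ^ 2 for the side lengths a_i.

   Triangles of alternating orientations cover a layer of height t of the
   parallelogram as soon as their n sides b_i satisfy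
   sum b_i >= 1 + (n + 1) t / 2. Stacking such layers greedily, in decreasing
   order of the sides, covers height y as soon as
   sum b_i ^ 2 >= b + 2 y + b y, where b bounds the sides. If the largest
   triangle is not too large, these layers cover the whole parallelogram.
   Otherwise it is put on the base, the next two triangles cover the two corners
   that it leaves below a suitable height, and layers of the others cover the
   strip above this height. All estimates hold with a slack proportional to
   1 + H - max a_i, which reduces an infinite family to a finite one. *)

Require Import Defs.
From HB Require Import structures.
From mathcomp Require Import all_boot all_order all_algebra.
From mathcomp Require Import all_classical all_reals all_analysis.
From mathcomp Require Import measurable_realfun.
From mathcomp Require Import ring lra.
Set Implicit Arguments.
Unset Strict Implicit.
Unset Printing Implicit Defensive.
Import Order.TTheory GRing.Theory Num.Theory numFieldNormedType.Exports.
Local Open Scope classical_set_scope.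
Local Open Scope ring_scope.

(** * Layers of tiles *)

Section Tiles.
Variable R : realFieldType.
Implicit Types (a b t y k v H : R) (l : seq R) (A B : R * R -> Prop) (p c : R * R).

(* Points are given by coordinates (u, v) along two sides of the triangle T, in
   which the homothetic copies of T of side a are the sets
   { u0 <= u, v0 <= v, u + v <= u0 + v0 + a } and their half-turns. *)
Definition tile (up : bool) a c p : bool :=
  if up then [&& c.1 <= p.1, c.2 <= p.2 & p.1 + p.2 <= c.1 + c.2 + a]
  else [&& p.1 <= c.1, p.2 <= c.2 & c.1 + c.2 - a <= p.1 + p.2].

(** Phrased as successive removal, so that partial coverings compose by induction on the list
    without any bookkeeping of positions. *)
Fixpoint covers l A : Prop :=
  if l is a :: l' then
    exists up c, covers l' (fun p => A p /\ ~~ tile up a c p)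
  else forall p, ~ A p.

Lemma covers_sub l A B : (forall p, A p -> B p) -> covers l B -> covers l A.
Proof.
elim: l A B => [|a l IH] A B AB /=; first by move=> nB p /AB /nB.
move=> [up [c cB]]; exists up, c; apply: IH cB => p [/AB Bp np].
by split.
Qed.

Lemma covers_cat l1 l2 A B :
  covers l1 A -> covers l2 B -> covers (l1 ++ l2) (fun p => A p \/ B p).
Proof.
elim: l1 A B => [|a l1 IH] A B /= cA cB.
  by apply: covers_sub cB => p [/cA|].
case: cA => up [c cA]; exists up, c.
by apply: covers_sub (IH _ _ cA cB) => p [[Ap|Bp] np]; [left|right].
Qed.

Lemma covers_catr l1 l2 B : covers l2 B -> covers (l1 ++ l2) B.
Proof.
elim: l1 => [|a l1 IH] //= /IH cB; exists true, 0.
by apply: covers_sub cB => p [].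
Qed.

Lemma covers0 l : covers l (fun=> False).
Proof. by rewrite -[l in covers l]cats0; apply: covers_catr => p. Qed.

Lemma covers_catl l1 l2 A : covers l1 A -> covers (l1 ++ l2) A.
Proof.
by move=> cA; apply: covers_sub (covers_cat cA (covers0 l2)) => p; left.
Qed.

Lemma covers_cons up c a l A B :
  (forall p, A p -> tile up a c p \/ B p) -> covers l B -> covers (a :: l) A.
Proof.
move=> AtB cB; exists up, c; apply: covers_sub cB => p [/AtB[->|//]].
by [].
Qed.

Lemma covers1 up a c A : (forall p, A p -> tile up a c p) -> covers [:: a] A.
Proof. by move=> At; exists up, c => p [/At ->]. Qed.

(** [k] measures how the parallelogram leans in the oblique coordinates: [k = 1 / 2] is a rectangle,
    [k = 0] has sides along the second axis. The strict lower bound makes stacked strips disjoint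
    and strips of height 0 empty. *)
Definition slab k v0 v1 p : bool :=
  [&& v0 < p.2, p.2 <= v1, - k * p.2 <= p.1 & p.1 <= 1 - k * p.2].

(* [tile true] leaves an edge of direction u + v = const on its right,
   [tile false] an edge of direction u = const, so tiles of alternating
   orientations fit together along a layer. *)
Definition chain_from (left_edge : bool) v0 t x l p : bool :=
  let e := x + \sum_(b <- l) b - (size l)./2%:R * t in
  [&& v0 <= p.2, p.2 <= v0 + t &
   if left_edge then
     (x <= p.1) && (if odd (size l) then p.1 + p.2 <= e + v0 else p.1 <= e)
   else (x <= p.1 + p.2) &&
     (if odd (size l) then p.1 <= e - v0 - t else p.1 + p.2 <= e)].

(** A tile contains the part of the row between its left and right edges, even if it is smaller than
    [t]; what remains is a chain starting from the other kind of edge. Two consecutive tiles advance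
    by the sum of their sides minus [t]. *)
Lemma covers_chain left_edge v0 t x a l :
  covers (a :: l) (chain_from left_edge v0 t x (a :: l)).
Proof.
elim: l left_edge x a => [|b l IH] [] x a.
- apply: (@covers1 true _ (x, v0)) => -[u v].
  rewrite /chain_from /tile /= big_seq1 => /and3P[h1 h2 /andP[h3 h4]].
  by apply/and3P; split => //; lra.
- apply: (@covers1 false _ (x + a - v0 - t, v0 + t)) => -[u v].
  rewrite /chain_from /tile /= big_seq1 => /and3P[h1 h2 /andP[h3 h4]].
  by apply/and3P; split => //; lra.
- have cl := IH false (x + v0 + a) b.
  apply: (@covers_cons true (x, v0) _ _ _ _ _ cl).
  move=> -[u v]; rewrite /chain_from /tile /= !big_cons uphalf_half natrD -natr1.
  move: (\sum_(_ <- _) _) (size l) => S n.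
  case: (odd n) => /= /and3P[h1 h2 /andP[h3 h4]];
    case: (lerP (u + v) (x + v0 + a)) => h5; [left|right|left|right];
    apply/and3P; split => //; try (apply/andP; split); lra.
- have cl := IH true (x + a - v0 - t) b.
  apply: (@covers_cons false (x + a - v0 - t, v0 + t) _ _ _ _ _ cl).
  move=> -[u v]; rewrite /chain_from /tile /= !big_cons uphalf_half natrD -natr1.
  move: (\sum_(_ <- _) _) (size l) => S n.
  case: (odd n) => /= /and3P[h1 h2 /andP[h3 h4]];
    case: (lerP u (x + a - v0 - t)) => h5; [left|right|left|right];
    apply/and3P; split => //; try (apply/andP; split); lra.
Qed.

(* The layer starts and ends with boundary losses of total length t. *)
Lemma covers_layer k v0 t l : 0 <= k <= 1 / 2 -> 0 < t ->
  1 + ((size l)%:R + 1) * t / 2 <= \sum_(b <- l) b ->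
  covers l (slab k v0 (v0 + t)).
Proof.
move=> /andP[k0 k1] t0; case: l => [|a l] hS.
  by move: hS; rewrite big_nil /=; lra.
(* The chain starts at the leftmost abscissa of the strip, attained at its top. *)
apply: covers_sub (covers_chain true v0 t (- k * (v0 + t)) a l) => -[u v].
rewrite /chain_from /slab; move: hS; move: (\sum_(_ <- _) _) => S.
(* The last edge depends on the parity of the number of tiles. An odd chain is critical at the top
   right and uses the hypothesis exactly; an even one is critical at the bottom right, where it
   loses [k * t] instead of [t / 2]. *)
have kt : 2 * k * t <= t by nra.
have : ((size (a :: l))%:R = (odd (size (a :: l)))%:R + 2 * (size (a :: l))./2%:R :> R).
  by rewrite -[in LHS](odd_double_half (size _)) natrD -mul2n natrM.
move: (size _)%:R (_./2)%:R => n m; case: (odd _) => /= -> hS.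
all: move=> /and4P[h1 h2 h3 h4]; have kv : k * v <= k * (v0 + t) by nra.
all: have kv' : k * v0 <= k * v by nra.
all: have kv2 : k * (v - v0 - t) >= (v - v0 - t) by nra.
all: apply/and3P; split; first (by lra); first (by lra).
all: by apply/andP; split; lra.
Qed.
(** The products [(x - t) * (b - x)] are nonnegative; their sum is expanded. *)
Lemma sum_sqr_le t b l : all (fun x => t <= x <= b) l ->
  \sum_(x <- l) x ^+ 2 <= (b + t) * (\sum_(x <- l) x) - (size l)%:R * (t * b).
Proof.
elim: l => [|a l IH] /=; first by rewrite !big_nil mulr0 mul0r subr0.
move=> /andP[/andP[ta ab] /IH]; rewrite !big_cons -natr1.
by move: (\sum_(_ <- _) _) (\sum_(_ <- _) _) (size l)%:R => S2 S n; nra.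
Qed.

(* The cost b + t + b t - ... of a layer of height t made of tiles of sizes in
   [t, b] is at most the decrease of the potential b + 2 y + b y when y drops
   by t and b drops to (n + 1) t / n. *)
Lemma potential_step (n b t y b' : R) : 1 <= n -> 0 < t -> t <= b -> t <= y ->
  1 + (n + 1) * t / 2 <= n * b -> b' = Num.min b ((n + 1) * t / n) ->
  b + t + b * t - (n + 1) * t * (b - t) / 2 + (b' + 2 * (y - t) + b' * (y - t))
    <= b + 2 * y + b * y.
Proof.
move=> n1 t0 tb ty nb ->; have n0 : 0 < n by lra.
(* The first bound controls the product of the new [b'] with [y - t]; the remaining terms amount to
   the second bound. *)
suff [b'b h] : Num.min b ((n + 1) * t / n) <= b /\
    Num.min b ((n + 1) * t / n) <= t + (n + 1) * t * (b - t) / 2.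
  by move: (Num.min _ _) b'b h => c cb h; nra.
split; first by rewrite ge_min lexx.
case: (lerP b ((n + 1) * t / n)) => [|]; rewrite ?ler_pdivlMr ?ltr_pdivrMr // => h.
  have : (b - t) * ((n + 1) * t / 2 - 1) >= 0 by apply: mulr_ge0; nra.
  by nra.
have h2 : 2 <= n * (n + 1) * (b - t).
  have [h3|h3] := lerP 2 ((n + 1) * t); first by nra.
  suff : 2 <= (n + 1) * (1 + (1 - n) * t / 2) by nra.
  by nra.
rewrite ler_pdivrMr //; nra.
Qed.

(** Greedy induction on the number of tiles. With [t j] the height of the layer that the first [j]
    tiles just cover, the layer is closed at the least [n] for which the next side is at most
    [t n.+1]. All its tiles then exceed [t n], which bounds the sum of squares spent, and the next
    side is at most [(n + 1) * t n / n], which lowers [b] for the rest. *)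
Lemma covers_shelf k b y v0 l : 0 <= k <= 1 / 2 -> sorted >=%R l ->
  0 <= b -> all (fun x => 0 < x <= b) l ->
  b + 2 * y + b * y <= \sum_(x <- l) x ^+ 2 ->
  covers l (slab k v0 (v0 + y)).
Proof.
move=> hk; have [m] := ubnP (size l); elim: m => // m IH in b y v0 l *.
rewrite ltnS => lem srt b0 lb hS.
have [y0|y0] := lerP y 0.
  apply: (@covers_sub _ _ (fun=> False)); last exact: covers0.
  by move=> p /and4P[]; lra.
have [l0|lN0] := posnP (size l).
  by move: hS; rewrite (size0nil l0) big_nil => hS; nra.
pose S j := \sum_(x <- take j l) x.
pose t j : R := 2 * (S j - 1) / (j%:R + 1).
have tE j : S j = 1 + (j%:R + 1) * t j / 2.
  rewrite /t; have : 0 <= j%:R :> R by [].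
  by move: j%:R => n n0; field; lra.
have SS j : (j < size l)%N -> S j.+1 = S j + l`_j.
  by move=> jl; rewrite /S (take_nth 0) // -cats1 big_cat big_seq1.
have lP j : (j < size l)%N -> 0 < l`_j <= b.
  by move=> jl; apply: (allP lb); apply: mem_nth.
have lS i j : (i <= j < size l)%N -> l`_j <= l`_i.
  move=> /andP[ij jl]; apply: (@sorted_leq_nth _ >=%R) => //.
  - by move=> x z w; apply: (rev_trans le_trans).
  - exact: lexx.
  - by rewrite inE; apply: leq_ltn_trans jl.
pose P j := (size l <= j)%N || (l`_j <= t j.+1).
have exP : exists j, P j by exists (size l); rewrite /P leqnn.
(* For a single tile, [t 1] is its side minus 1, so the search does not stop at 0. *)
case: (ex_minnP exP) => n Pn nmin; have n0 : (0 < n)%N.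
  rewrite lt0n; apply/eqP => n0; move: Pn; rewrite n0 /P leqNgt lN0 /=.
  have := tE 1%N; rewrite SS // /S take0 big_nil.
  by have /andP[] := lP _ lN0; lra.
have nl : (n <= size l)%N by apply: nmin; rewrite /P leqnn.
have tn j : (j < n)%N -> t n < l`_j.
  move=> jn; apply: (@lt_le_trans _ _ l`_n.-1); last first.
    by apply: lS; rewrite -ltnS prednK // jn.
  rewrite ltNge -(prednK n0) /=; apply/negP => h.
  suff /nmin : P n.-1 by rewrite -ltnS prednK // ltnn.
  by rewrite /P h orbT.
have szn : size (take n l) = n by rewrite size_takel.
have mem_take x : x \in take n l -> exists2 j, (j < n)%N & x = l`_j.
  by move=> /(nthP 0)[j]; rewrite szn => jn <-; exists j; rewrite ?nth_take.
have layer : 0 < t n -> covers (take n l) (slab k v0 (v0 + t n)).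
  by move=> tn0; apply: covers_layer; rewrite // szn -tE.
have [ty|ty] := lerP y (t n).
  rewrite -(cat_take_drop n l); apply: covers_catl.
  apply: covers_sub (layer _); last by lra.
  by move=> p /and4P[*]; apply/and4P; split => //; lra.
(* If the tiles run out early, [t n] may be negative, hence the maximum with 0. *)
have hn : all (fun x => Num.max 0 (t n) <= x <= b) (take n l).
  apply/allP => x /mem_take[j jn ->]; have /andP[l0 ->] := lP j (leq_trans jn nl).
  by rewrite andbT ge_max !ltW // tn.
have := sum_sqr_le hn; rewrite szn -/(S n) tE.
have n1 : 1 <= n%:R :> R by rewrite ler1n.
have tb : t n < b.
  by apply: lt_le_trans (tn _ n0) _; case/andP: (lP _ lN0).
move: (tE n) => SnE.
(* A layer that uses up all tiles and is still lower than [y] contradicts the assumed sum of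
   squares. *)
have [nl'|nl'] := leqP (size l) n.
  rewrite take_oversize // => h; exfalso; move: h hS.
  move: (\sum_(_ <- _) _) => S2; case: (lerP 0 (t n)) => h ? ?.
    have : 0 <= (n%:R + 1) * t n * (b - t n).
      by apply: mulr_ge0; [apply: mulr_ge0|]; lra.
    have : 0 <= b * (y - t n) by apply: mulr_ge0; lra.
    by lra.
  have : 0 <= (n%:R + 1) * b * - t n.
    by apply: mulr_ge0; [apply: mulr_ge0|]; lra.
  have : 0 <= b * y by apply: mulr_ge0; lra.
  by lra.
rewrite /P leqNgt nl' /= in Pn.
have [ln0 lnb] := andP (lP _ nl').
(* Since (n + 2) t_(n+1) = (n + 1) t_n + 2 l_n, the stopping rule bounds the next side in terms of
   [t n] alone. *)
have lnt : l`_n <= (n%:R + 1) * t n / n%:R.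
  have := tE n.+1; rewrite SS // SnE -[n.+1%:R]natr1 ler_pdivlMr; last by lra.
  have : 0 <= n%:R * (t n.+1 - l`_n) by apply: mulr_ge0; lra.
  by lra.
have tn0 : 0 < t n.
  rewrite ltNge; apply/negP => t0; suff : (n%:R + 1) * t n / n%:R <= 0 by lra.
  by rewrite ler_pdivrMr; nra.
rewrite (max_idPr (ltW tn0)) => h.
pose b' := Num.min b ((n%:R + 1) * t n / n%:R).
have Snb : S n <= n%:R * b.
  rewrite /S -{2}szn; elim: (take n l) hn => [|x s IHs] /=.
    by rewrite big_nil mul0r.
  move=> /andP[/andP[_ xb] /IHs]; rewrite big_cons -natr1; lra.
have := @potential_step n%:R b (t n) y b' n1 tn0 (ltW tb) (ltW ty).
rewrite -tE => /(_ Snb erefl) step.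
have rest : covers (drop n l) (slab k (v0 + t n) (v0 + t n + (y - t n))).
  apply: (IH b').
  - by rewrite size_drop; apply: leq_trans lem; rewrite ltn_subrL n0.
  - exact: drop_sorted.
  - by rewrite le_min b0; lra.
  - apply/allP => x /(nthP 0)[j]; rewrite size_drop nth_drop => jl <-.
    have jl' : (n + j < size l)%N by rewrite -ltn_subRL.
    have [-> hb] := andP (lP _ jl'); rewrite le_min hb.
    by apply: le_trans lnt; apply: lS; rewrite leq_addr.
  - move: hS; rewrite -{1}(cat_take_drop n l) big_cat /=.
    move: (\sum_(_ <- drop _ _) _) => S2 hS.
    by move: (\sum_(_ <- take _ _) _) (t n) n%:R h hS step => S1 tt nn; lra.
rewrite -(cat_take_drop n l); apply: covers_sub (covers_cat (layer tn0) rest).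
move=> p /and4P[? ? ? ?]; case: (lerP p.2 (v0 + t n)) => ?; [left|right].
  by apply/and4P; split.
by apply/and4P; split => //; lra.
Qed.
End Tiles.

(** * Corners *)

Section Tiles.
Variable R : realFieldType.
Implicit Types (a b t y k v H : R) (l : seq R) (A B : R * R -> Prop) (p c : R * R).

Definition skew_box k H p : bool :=
  [&& 0 <= p.2, p.2 <= H, - k * p.2 <= p.1 & p.1 <= 1 - k * p.2].

(* Sliding an upward tile along the base of the parallelogram leaves two
   corners uncovered; a downward tile of size b at the right corner makes up for
   (1 - k) b of the missing size, one of size c at the left corner for k c. *)
Definition right_corner k H b p : bool :=
  skew_box k H p && (1 + (1 - k) * (H - b) < p.1 + p.2).

Definition left_corner k H b p : bool :=
  skew_box k H p && (p.1 < - k * (H - b)).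

(** The tile hangs from the top, with its lowest vertex on the right side of the parallelogram at
    height [H - b]. *)
Lemma covers_right_corner k H b : 0 <= k <= 1 / 2 ->
  covers [:: b] (right_corner k H b).
Proof.
move=> /andP[k0 k1]; apply: (@covers1 _ false _ (1 - k * (H - b), H)) => -[u v].
rewrite /tile /= => /andP[/and4P[/= v0 vH ku uk] h].
have vb : H - b < v by rewrite -(@ltr_pM2l _ (1 - k)); lra.
have : k * (H - b) <= k * v by apply: ler_wpM2l => //; lra.
by move=> hk; apply/and3P; split; lra.
Qed.

(** The lowest vertex of the tile now lies on the left side, at height [H - b]. *)
Lemma covers_left_corner k H b : 0 <= k <= 1 / 2 ->
  covers [:: b] (left_corner k H b).
Proof.
move=> /andP[k0 k1]; apply: (@covers1 _ false _ (- k * (H - b), H)) => -[u v].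
rewrite /tile /= => /andP[/and4P[/= v0 vH ku uk] h].
have vb : H - b < v.
  rewrite ltNge; apply/negP => vb.
  have : k * v <= k * (H - b) by apply: ler_wpM2l.
  by lra.
have : (1 - k) * (H - b) <= (1 - k) * v by apply: ler_wpM2l; lra.
by move=> hk; apply/and3P; split; lra.
Qed.

(** The tile [a] stands on the base with its left edge along the left corner. With next sides
    [b >= c], its right edge reaches the right corner as soon as [1 + H <= a + (1 - k) * b + k * c];
    for [k <= 1 / 2] this weighted sum is at least the plain mean of [b] and [c]. *)
Lemma covers_corners k H a l : 0 <= k <= 1 / 2 ->
  l`_1 <= l`_0 -> 1 + H <= a + (l`_0 + l`_1) / 2 ->
  covers (a :: take 2 l) (skew_box k H).
Proof.
move=> hk; have /andP[k0 k1] := hk; move=> l10 ha.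
have {}ha : 1 + H <= a + (1 - k) * l`_0 + k * l`_1.
  have : 0 <= (1 / 2 - k) * (l`_0 - l`_1) by apply: mulr_ge0; lra.
  by lra.
apply: (@covers_cons _ true (- k * (H - l`_1), 0) _ _ _
  (fun p => right_corner k H l`_0 p \/ left_corner k H l`_1 p)).
  move=> [u v] hp; have /and4P[/= v0 vH ku uk] := hp.
  rewrite /right_corner /left_corner hp /tile /= v0.
  have [?|?] := ltrP u (- k * (H - l`_1)); first by right; right.
  have [?|?] := ltrP (1 + (1 - k) * (H - l`_0)) (u + v); first by right; left.
  by left => /=; lra.
(* Missing entries of [l] have the default value 0, and corners of size 0 are empty. *)
have rc0 p : ~~ right_corner k H 0 p.
  by apply/negP => /andP[/and4P[]]; nra.
have lc0 p : ~~ left_corner k H 0 p.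
  by apply/negP => /andP[/and4P[]]; nra.
case: l {l10 ha} => [|b [|c l]] /=.
- by move=> p [|]; apply/negP.
- apply: covers_sub (covers_right_corner H b hk) => p [//|].
  by rewrite (negPf (lc0 p)).
- rewrite take0; apply: (@covers_cat _ [:: b] [:: c]).
    exact: covers_right_corner.
  exact: covers_left_corner.
Qed.

(* The left-hand side exceeds the budget of [covers_shelf] for a strip of height
   y and tiles of size at most c by the three squares already spent; the
   difference of the two sides is concave in (a, b, c). *)
Lemma corner_budget H a b (c : R) y : 10 / 9 <= H <= 7 / 6 ->
  (H + 1) / 2 - 1 / 100 <= a -> 0 <= c -> c <= b -> b <= a ->
  y = 1 + H - a - (b + c) / 2 -> 0 < y ->
  c + 2 * y + c * y + a ^+ 2 + b ^+ 2 + c ^+ 2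
    <= (1 + H) ^+ 2 - (1 + H - a) / 100.
Proof.
move=> /andP[H0 H1] aA c0 cb ba -> y0.
(* [e] is the amount by which the tile [a] falls short of the full size [1 + H]. *)
pose e := 1 + H - a; have aE : a = 1 + H - e by rewrite /e; lra.
move: e aE aA ba y0 => e ->{a} eA be y0.
have e0 : 0 < e by lra.
suff : 0 <= e * (2 * H - 1 / 100 - e) + b - b ^+ 2 - c ^+ 2 / 2 - c * (e - b / 2).
  by lra.
(* For [b <= e] the worst value of [c] is [b]. Otherwise [y > 0] keeps [c] below [2 * e - b], and
   this extreme value is the worst. *)
have [hbe|heb] := lerP b e.
  have h1 : 0 <= (b - c) * (e - b / 2 + (b + c) / 2) by apply: mulr_ge0; lra.
  suff : 0 <= e * (2 * H - 1 / 100 - e) + b * (1 - b - e) by lra.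
  have h2 : 0 <= b * (e - b) by apply: mulr_ge0; lra.
  have [h4|h4] := lerP (2 * e) 1.
    have : 0 <= b * (1 - 2 * e) by apply: mulr_ge0; lra.
    have : 0 <= e * (2 * H - 1 / 100 - e) by apply: mulr_ge0; lra.
    by lra.
  have : 0 <= (e - b) * (2 * e - 1) by apply: mulr_ge0; lra.
  have : 0 <= e * (2 * H + 1 - 1 / 100 - 3 * e) by apply: mulr_ge0; lra.
  by lra.
have h1 : 0 <= (2 * e - b - c) * (c + 2 * (2 * e - b)) by apply: mulr_ge0; lra.
have h2 : 0 <= (b - e) * (2 * e - b) by apply: mulr_ge0; lra.
suff : b * (2 * e - 1) <= e * (2 * H - 1 / 100 - e) by lra.
have [h4|h4] := lerP (2 * e) 1.
  have : 0 <= b * (1 - 2 * e) by apply: mulr_ge0; lra.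
  have : 0 <= e * (2 * H - 1 / 100 - e) by apply: mulr_ge0; lra.
  by lra.
(* Two upper bounds for [b] are at hand: [2 * e] serves for small [e], and [1 + H - e] for large
   [e]. *)
have [h5|h5] := lerP e (5 / 6).
  have : 0 <= (2 * e - b) * (2 * e - 1) by apply: mulr_ge0; lra.
  have : 0 <= e * (2 * H + 2 - 1 / 100 - 5 * e) by apply: mulr_ge0; lra.
  by lra.
have : 0 <= (1 + H - e - b) * (2 * e - 1) by apply: mulr_ge0; lra.
have : 0 <= ((1 + H) / 2 - e) * (3 + 1 / 100 - (1 + H) / 2 - e).
  by apply: mulr_ge0; lra.
have : 0 <= (1 + H) * ((1 + H) / 4 - (1 / 2 + 1 / 200)) by apply: mulr_ge0; lra.
by lra.
Qed.

(* A largest tile of size at most (H + 1) / 2 - 1 / 100 leaves enough room for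
   the layers alone; a larger one is completed by two corners and a strip of
   layers. The slack (1 + H - l`_0) / 100 makes the statement applicable to
   finite subfamilies of an infinite family. *)
Theorem covers_skew_box k H l : 0 <= k <= 1 / 2 -> 10 / 9 <= H <= 7 / 6 ->
  sorted >=%R l -> all (fun x => 0 < x < 1 + H) l ->
  (1 + H) ^+ 2 - (1 + H - l`_0) / 100 <= \sum_(x <- l) x ^+ 2 ->
  covers l (skew_box k H).
Proof.
move=> hk /andP[H0 H1]; case: l => [|a l] srt.
  by rewrite big_nil /= => _; nra.
rewrite big_cons => /andP[/andP[a0 aH] /allP lH]; rewrite [_`_0]/= => hS.
have pl := srt; rewrite /= path_sortedE in pl; last exact: (rev_trans le_trans).
have [/allP la srtl] := andP pl.
have [aA|aA] := lerP a ((H + 1) / 2 - 1 / 100).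
  have := @covers_shelf R k a (H + 1 / 300) (- (1 / 300)) (a :: l) hk srt.
  have -> : - (1 / 300) + (H + 1 / 300) = H by lra.
  move=> cs; apply: covers_sub (cs _ _ _).
    by move=> p /and4P[*]; apply/and4P; split => //; lra.
  - exact: ltW.
  - apply/allP => x; rewrite inE => /predU1P[->|xl]; first by rewrite a0 lexx.
    by have /andP[-> _] := lH _ xl; apply: la.
  - rewrite big_cons; apply: le_trans hS; nra.
have l10 : 0 <= l`_1 <= l`_0 /\ l`_0 <= a.
  case: l srtl la lH {hS srt pl} => [|b [|c l]] /=.
  - by rewrite !lexx; lra.
  - by move=> _ /(_ b); rewrite inE eqxx => ba /(_ b); rewrite inE eqxx; lra.
  - move=> /andP[cb _] /(_ b); rewrite inE eqxx => ba /(_ c).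
    by rewrite !inE eqxx orbT; lra.
have [/andP[c0 cb] ba] := l10.
(* The largest tile and the two corner tiles cover the box up to height [H - y]. *)
pose y := 1 + H - a - (l`_0 + l`_1) / 2.
have -> : a :: l = (a :: take 2 l) ++ drop 2 l by rewrite /= cat_take_drop.
have [y0|y0] := lerP y 0.
  by apply/covers_catl/covers_corners => //; rewrite /y in y0; lra.
have cor : covers (a :: take 2 l) (skew_box k (H - y)).
  by apply: covers_corners => //; rewrite /y; lra.
have rest : covers (drop 2 l) (slab k (H - y) (H - y + y)).
  apply: (@covers_shelf _ _ l`_1) => //.
  - exact: drop_sorted.
  - apply/allP => x xl; have /lH/andP[-> _] : x \in l by apply: mem_drop xl.
    case: l srtl xl {hS srt pl la lH l10 c0 cb ba y y0 cor} => [|b [|c l]] //=.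
    rewrite drop0 => /andP[_]; rewrite path_sortedE.
      by move=> /andP[/allP h _] /h.
    exact: (rev_trans le_trans).
  have := @corner_budget H a l`_0 l`_1 y _ (ltW aA) c0 cb ba erefl y0.
  rewrite H0 H1 => /(_ isT) bud; rewrite -(lerD2l (a ^+ 2 + (l`_0 ^+ 2 + l`_1 ^+ 2))).
  have eS : \sum_(x <- l) x ^+ 2 =
      l`_0 ^+ 2 + l`_1 ^+ 2 + \sum_(x <- drop 2 l) x ^+ 2.
    clear; case: l => [|b [|c l]] /=; rewrite ?drop0 ?big_cons ?big_nil; lra.
  by move: hS; rewrite eS /=; lra.
apply: covers_sub (covers_cat cor rest) => p /and4P[? ? ? ?].
case: (lerP p.2 (H - y)) => ?; [left|right]; apply/and4P; split => //; lra.
Qed.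
End Tiles.

(** * Convex hulls and sides *)

Section Geometry.
Variable R : realType.
Implicit Types (x y u e f : R * R) (P T C : set (R * R)) (s t k : R).

Lemma pt_eq x y : x.1 = y.1 -> x.2 = y.2 -> x = y.
Proof. by case: x y => [? ?] [? ?] /= -> ->. Qed.

Definition closed_under_segments C :=
  forall x y t, C x -> C y -> 0 <= t <= 1 -> C (x + t *: (y - x)).

Lemma convex_setP C :
  @convex_set R (R * R)%type C <-> closed_under_segments C.
Proof.
split=> [cC x y t Cx Cy /andP[t0 t1]|cC x y t].
  have /set_mem := cC y x (Itv01 t0 t1) (mem_set Cy) (mem_set Cx).
  congr C; apply: pt_eq; rewrite /= /unstable.onem /GRing.scale /=; ring.
move=> /set_mem Cx /set_mem Cy; apply/mem_set.
have := cC y x t%:num Cy Cx; rewrite ge0 le1 => /(_ isT).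
by congr C; apply: pt_eq; rewrite /= /unstable.onem /GRing.scale /=; ring.
Qed.

Lemma hull_min P C : closed_under_segments C -> P `<=` C -> hull P `<=` C.
Proof. by move=> /convex_setP cC PC; apply: smallest_sub. Qed.

Lemma hull_segments P : closed_under_segments (hull P).
Proof.
move=> x y t Px Py t01 C [/convex_setP cC PC].
have CP : [set M | @convex_set R (R * R)%type M /\ P `<=` M] C.
  by split => //; apply/convex_setP.
exact: cC (Px _ CP) (Py _ CP) t01.
Qed.

Lemma sub_hull P : P `<=` hull P. Proof. exact: sub_gen_smallest. Qed.

Definition pgram a e f : set (R * R) :=
  [set x | exists s t, [/\ 0 <= s <= 1, 0 <= t <= 1 & x = a + s *: e + t *: f]].

Definition tri a e f : set (R * R) :=
  [set x | exists s t, [/\ 0 <= s, 0 <= t, s + t <= 1 & x = a + s *: e + t *: f]].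

Lemma hull2E (a b : R * R) :
  hull [set a; b] = [set x | exists2 t, 0 <= t <= 1 & x = a + t *: (b - a)].
Proof.
apply/seteqP; split => [|x [t t01 ->]].
  apply: hull_min => [_ _ t [s1 hs1 ->] [s2 hs2 ->] ht|x [->|->]].
  - exists (s1 + t * (s2 - s1)); first by nra.
    by apply: pt_eq; rewrite /= /GRing.scale /=; ring.
  - by exists 0; rewrite ?lexx ?ler01 // scale0r addr0.
  - by exists 1; rewrite ?lexx ?ler01 // scale1r addrC subrK.
by apply: hull_segments => //; apply: sub_hull; [left|right].
Qed.

Lemma hull3E (a b c : R * R) : hull [set a; b; c] = tri a (b - a) (c - a).
Proof.
apply/seteqP; split => [|x [s [t [s0 t0 st ->]]]].
  apply: hull_min => [_ _ t [s1 [t1 [? ? ? ->]]] [s2 [t2 [? ? ? ->]]] ht|x [[|]|] ->].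
  - exists (s1 + t * (s2 - s1)), (t1 + t * (t2 - t1)); split; [nra|nra|nra|].
    by apply: pt_eq; rewrite /= /GRing.scale /=; ring.
  - by exists 0, 0; split; [lra|lra|lra|rewrite !scale0r !addr0].
  - exists 1, 0; split; [lra|lra|lra|].
    by rewrite scale0r addr0 scale1r addrC subrK.
  - exists 0, 1; split; [lra|lra|lra|].
    by rewrite scale0r addr0 scale1r addrC subrK.
have ha : hull [set a; b; c] a by apply: sub_hull; left; left.
have hb : hull [set a; b; c] b by apply: sub_hull; left; right.
have hc : hull [set a; b; c] c by apply: sub_hull; right.
have [st0|st0] := eqVneq (s + t) 0.
  have -> : s = 0 by lra.
  have -> : t = 0 by lra.
  by rewrite !scale0r !addr0.
have st1 : 0 < s + t by rewrite lt_neqAle eq_sym st0 addr_ge0.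
have ht : 0 <= t / (s + t) <= 1.
  by apply/andP; split; [apply: divr_ge0; lra|rewrite ler_pdivrMr; lra].
have hst : 0 <= s + t <= 1 by lra.
have := hull_segments ha (hull_segments hb hc ht) hst.
congr hull; apply: pt_eq; rewrite /= /GRing.scale /=; field; lra.
Qed.

Lemma hull4E (a b c d : R * R) : b - a = c - d ->
  hull [set a; b; c; d] = pgram a (b - a) (d - a).
Proof.
move=> abcd; have cE : c = a + (b - a) + (d - a).
  by rewrite abcd; apply: pt_eq; rewrite /=; ring.
apply/seteqP; split => [|x [s [t [s01 t01 ->]]]].
  apply: hull_min => [_ _ t [s1 [t1 [? ? ->]]] [s2 [t2 [? ? ->]]] ht|x [[[|]|]|] ->].
  - exists (s1 + t * (s2 - s1)), (t1 + t * (t2 - t1)); split; [nra|nra|].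
    by apply: pt_eq; rewrite /= /GRing.scale /=; ring.
  - by exists 0, 0; split; [lra|lra|rewrite !scale0r !addr0].
  - exists 1, 0; split; [lra|lra|].
    by rewrite scale0r addr0 scale1r addrC subrK.
  - by exists 1, 1; split; [lra|lra|rewrite !scale1r -cE].
  - exists 0, 1; split; [lra|lra|].
    by rewrite scale0r addr0 scale1r addrC subrK.
have ha : hull [set a; b; c; d] a by apply: sub_hull; left; left; left.
have hb : hull [set a; b; c; d] b by apply: sub_hull; left; left; right.
have hc : hull [set a; b; c; d] c by apply: sub_hull; left; right.
have hd : hull [set a; b; c; d] d by apply: sub_hull; right.
have := hull_segments (hull_segments ha hb s01) (hull_segments hd hc s01) t01.
by congr hull; apply: pt_eq; rewrite /= /GRing.scale /= cE /=; ring.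
Qed.

(** * Directions of the sides of a triangle and of a parallelogram *)

Lemma dotD u x y : dot u (x + y) = dot u x + dot u y.
Proof. by rewrite /dot /=; ring. Qed.

Lemma dotB u x y : dot u (x - y) = dot u x - dot u y.
Proof. by rewrite /dot /=; ring. Qed.

Lemma dotZ u t x : dot u (t *: x) = t * dot u x.
Proof. by rewrite /dot /= /GRing.scale /=; ring. Qed.

Lemma dotC x y : dot x y = dot y x.
Proof. by rewrite /dot; ring. Qed.

(** Each component of [u] annihilates the determinant of [x] and [y]. *)
Lemma parallel_orthogonal u x y : u <> 0 -> dot u x = 0 -> dot u y = 0 ->
  parallel x y.
Proof.
case: u x y => [u1 u2] [x1 x2] [y1 y2]; rewrite /dot /parallel /= => u0 hx hy.
have h1 : u1 * (x1 * y2 - x2 * y1) = 0.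
  transitivity ((u1 * x1 + u2 * x2) * y2 - x2 * (u1 * y1 + u2 * y2)); first ring.
  by rewrite hx hy mul0r mulr0 subrr.
have h2 : u2 * (x1 * y2 - x2 * y1) = 0.
  transitivity (x1 * (u1 * y1 + u2 * y2) - y1 * (u1 * x1 + u2 * x2)); first ring.
  by rewrite hx hy !mulr0 subrr.
apply/eqP; rewrite -subr_eq0; apply/negP => /negP D.
apply: u0; apply: pt_eq => /=.
  by apply/eqP; move/eqP: h1; rewrite mulf_eq0 (negPf D) orbF.
by apply/eqP; move/eqP: h2; rewrite mulf_eq0 (negPf D) orbF.
Qed.

Lemma is_side_supported P (r s : R * R) : is_side P r s -> exists u c,
  [/\ u <> 0, forall x, P x -> dot u x <= c, P r /\ P s, dot u r = c & dot u s = c].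
Proof.
move=> [_ [u [c [u0 Pc PE]]]]; exists u, c.
have [Pr ur] : (P `&` [set x | dot u x = c]) r by rewrite PE; apply: sub_hull; left.
have [Ps us] : (P `&` [set x | dot u x = c]) s by rewrite PE; apply: sub_hull; right.
by split.
Qed.

(** A side is orthogonal to its normal [u], hence parallel to any edge vector orthogonal to [u]; if
    there were none, the supporting line would meet the triangle in one point. *)
Lemma is_side_tri a e f (r s : R * R) : is_side (tri a e f) r s ->
  [\/ parallel (s - r) e, parallel (s - r) f | parallel (s - r) (f - e)].
Proof.
move=> sd; have [rs _] := sd.
have [u [c [u0 hc [[r1 [r2 [r10 r20 r12 rE]]] [s1 [s2 [s10 s20 s12 sE]]]] ur us]]] :=
  is_side_supported sd.
have par x : dot u x = 0 -> parallel (s - r) x.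
  by apply: parallel_orthogonal => //; rewrite dotB us ur subrr.
have ha : dot u a <= c.
  by apply: hc; exists 0, 0; split; [lra|lra|lra|rewrite !scale0r !addr0].
have he : dot u a + dot u e <= c.
  rewrite -dotD; apply: hc; exists 1, 0.
  by split; [lra|lra|lra|rewrite scale0r scale1r !addr0].
have hf : dot u a + dot u f <= c.
  rewrite -dotD; apply: hc; exists 0, 1.
  by split; [lra|lra|lra|rewrite scale0r scale1r addr0].
have {}ur : dot u a + r1 * dot u e + r2 * dot u f = c.
  by rewrite -!dotZ -!dotD -rE.
have {}us : dot u a + s1 * dot u e + s2 * dot u f = c.
  by rewrite -!dotZ -!dotD -sE.
have [e0|/eqP e0] := eqVneq (dot u e) 0; first by constructor 1; apply: par.
have [f0|/eqP f0] := eqVneq (dot u f) 0; first by constructor 2; apply: par.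
have [ef|/eqP ef] := eqVneq (dot u f) (dot u e).
  by constructor 3; apply: par; rewrite dotB ef subrr.
(* Otherwise a single vertex maximises [dot u]. *)
exfalso; apply: rs.
rewrite rE sE; suff [-> ->] : r1 = s1 /\ r2 = s2 by [].
move: {par hc} (dot u e) (dot u f) (dot u a) e0 f0 ef ha he hf ur us => E F A.
move=> e0 f0 ef ha he hf ur us.
(* Complementary slackness: a barycentric weight vanishes unless its vertex lies on the supporting
   line. *)
have slack (x y : R) : 0 <= x -> 0 <= y -> x + y <= 1 -> A + x * E + y * F = c ->
   [/\ x * (c - A - E) = 0, y * (c - A - F) = 0 & (1 - x - y) * (c - A) = 0].
  move=> x0 y0 xy h.
  have h1 : 0 <= x * (c - A - E) by apply: mulr_ge0; lra.
  have h2 : 0 <= y * (c - A - F) by apply: mulr_ge0; lra.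
  have h3 : 0 <= (1 - x - y) * (c - A) by apply: mulr_ge0; lra.
  by split; lra.
have [xr yr zr] := slack _ _ r10 r20 r12 ur.
have [xs ys zs] := slack _ _ s10 s20 s12 us.
have zero (x y : R) : x * y = 0 -> y <> 0 -> x = 0.
  by move=> /eqP; rewrite mulf_eq0 => /orP[/eqP|/eqP].
have [cA|/eqP cA] := eqVneq (c - A) 0.
  rewrite (zero _ _ xr) ?(zero _ _ yr) ?(zero _ _ xs) ?(zero _ _ ys) //; lra.
have zr' := zero _ _ zr cA; have zs' := zero _ _ zs cA.
have [cE|/eqP cE] := eqVneq (c - A - E) 0.
  have cF : c - A - F <> 0 by lra.
  by have := zero _ _ yr cF; have := zero _ _ ys cF; lra.
by have := zero _ _ xr cE; have := zero _ _ xs cE; lra.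
Qed.

Lemma is_side_pgram a e f (r s : R * R) : is_side (pgram a e f) r s ->
  parallel (s - r) e \/ parallel (s - r) f.
Proof.
move=> sd; have [rs _] := sd.
have [u [c [u0 hc [[r1 [r2 [r10 r20 rE]]] [s1 [s2 [s10 s20 sE]]]] ur us]]] :=
  is_side_supported sd.
have par x : dot u x = 0 -> parallel (s - r) x.
  by apply: parallel_orthogonal => //; rewrite dotB us ur subrr.
have corner (x y : R) : 0 <= x <= 1 -> 0 <= y <= 1 ->
    dot u a + x * dot u e + y * dot u f <= c.
  by move=> hx hy; rewrite -!dotZ -!dotD; apply: hc; exists x, y.
have {}ur : dot u a + r1 * dot u e + r2 * dot u f = c.
  by rewrite -!dotZ -!dotD -rE.
have {}us : dot u a + s1 * dot u e + s2 * dot u f = c.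
  by rewrite -!dotZ -!dotD -sE.
have [e0|/eqP e0] := eqVneq (dot u e) 0; first by left; apply: par.
have [f0|/eqP f0] := eqVneq (dot u f) 0; first by right; apply: par.
exfalso; apply: rs.
rewrite rE sE; suff [-> ->] : r1 = s1 /\ r2 = s2 by [].
have h0 : 0 <= (0 : R) <= 1 by lra.
have h1 : 0 <= (1 : R) <= 1 by lra.
have := corner _ _ h0 h0; have := corner _ _ h0 h1.
have := corner _ _ h1 h0; have := corner _ _ h1 h1.
move: {par corner hc} (dot u e) (dot u f) (dot u a) e0 f0 ur us => E F A.
move=> e0 f0 ur us c11 c10 c01 c00.
have inj (x y D : R) : D <> 0 -> x * D = y * D -> x = y.
  by move=> /eqP D0; apply: mulIf.
(* Each coordinate contributes at most its separate maximum, hence exactly this; nonzero slopes then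
   determine the coordinates. *)
have max_eq (x D : R) : 0 <= x <= 1 -> x * D <= Num.max 0 D.
  by move=> hx; case: (lerP 0 D) => hD; nra.
have := max_eq _ E r10; have := max_eq _ E s10.
have := max_eq _ F r20; have := max_eq _ F s20.
have : A + Num.max 0 E + Num.max 0 F <= c.
  by case: (lerP 0 E); case: (lerP 0 F); lra.
move: (Num.max 0 E) (Num.max 0 F) => mE mF *.
by split; [apply: (inj _ _ E)|apply: (inj _ _ F)] => //; lra.
Qed.
End Geometry.

(** * Homotheties and rigid motions *)

Section Geometry.
Variable R : realType.
Implicit Types (x y z u e f v : R * R) (P T C : set (R * R)) (s t k : R).

Ltac vec := apply: pt_eq; rewrite /= /GRing.scale /=; ring.

(** Stated with two difference vectors, so that it applies directly to the points of a triangle;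
    [t = 0] gives segments. *)
Definition affine (g : R * R -> R * R) := forall x y z s t,
  g (x + s *: (y - x) + t *: (z - x)) = g x + s *: (g y - g x) + t *: (g z - g x).

Definition homothety k v x : R * R := k *: x + v.

Lemma affine_homothety k v : affine (homothety k v).
Proof. by move=> x y z s t; rewrite /homothety; vec. Qed.

Lemma affine_segment g x y t : affine g -> g (x + t *: (y - x)) = g x + t *: (g y - g x).
Proof.
by move=> /(_ x y y t 0); rewrite !scale0r !addr0.
Qed.

Lemma affine_hull2 g (a b : R * R) : affine g ->
  g @` hull [set a; b] = hull [set g a; g b].
Proof.
move=> ag; rewrite !hull2E; apply/seteqP; split => [_ [_ [t t01 ->] <-]|_ [t t01 ->]].
  by exists t; rewrite // affine_segment.
by exists (a + t *: (b - a)); [exists t|rewrite affine_segment].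
Qed.

Lemma affine_hull3 g (a b c : R * R) : affine g ->
  g @` hull [set a; b; c] = hull [set g a; g b; g c].
Proof.
move=> ag; rewrite !hull3E; apply/seteqP.
split => [_ [_ [s [t [s0 t0 st ->]]] <-]|_ [s [t [s0 t0 st ->]]]].
  by exists s, t; split => //; rewrite ag.
exists (a + s *: (b - a) + t *: (c - a)); last by rewrite ag.
by exists s, t.
Qed.

(** The normal is scaled by [k] too, so the functional is scaled by [k ^+ 2 > 0] and negative ratios
    preserve the supporting inequality. *)
Lemma is_side_homothety k v P (p q : R * R) : k != 0 -> is_side P p q ->
  is_side (homothety k v @` P) (homothety k v p) (homothety k v q).
Proof.
move=> k0 [pq [u [c [u0 Pc PE]]]]; split.
  by move=> /addIr/(scalerI k0).
have dE x : dot (k *: u) (homothety k v x) = k ^+ 2 * dot u x + k * dot u v.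
  by rewrite /dot /homothety /= /GRing.scale /=; ring.
exists (k *: u), (k ^+ 2 * c + k * dot u v); split.
- by move=> /eqP; rewrite scaler_eq0 (negPf k0) => /eqP.
- by move=> _ [x Px <-]; rewrite dE lerD2r ler_wpM2l ?sqr_ge0 ?Pc.
- rewrite -(affine_hull2 p q (affine_homothety k v)) -PE; apply/seteqP; split => x.
    move=> [[y Py <-]] /=; rewrite dE => /addIr/(mulfI (expf_neq0 2 k0)) yc.
    by exists y.
  by move=> [y [Py yc] <-]; split; [exists y|rewrite /= dE yc].
Qed.

Lemma rigid_motionP g : rigid_motion g ->
  affine g /\ forall x y, dot (g y - g x) (g y - g x) = dot (y - x) (y - x).
Proof.
elim=> [v|o th|g1 g2 _ [a1 d1] _ [a2 d2]]; split.
- by move=> x y z s t; rewrite /translation; vec.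
- by move=> x y; rewrite /translation /dot /=; ring.
- by move=> x y z s t; rewrite /rotation; vec.
- move=> x y; rewrite /rotation /dot /=.
  transitivity ((cos th ^+ 2 + sin th ^+ 2) *
    ((y.1 - x.1) * (y.1 - x.1) + (y.2 - x.2) * (y.2 - x.2))); first ring.
  by rewrite cos2Dsin2 mul1r.
- by move=> x y z s t /=; rewrite a2 a1.
- by move=> x y /=; rewrite d1 d2.
Qed.

(** For [k' = - k] the motion is the half-turn about the midpoint of [v] and [v']. *)
Lemma rigid_motion_hom (k k' : R) (v v' : R * R) : `|k'| = `|k| ->
  exists2 g, rigid_motion g & forall x, g (homothety k v x) = homothety k' v' x.
Proof.
move=> /eqP; rewrite eqr_norm2 => /orP[/eqP ->|/eqP ->].
  exists (translation (v' - v)); first by constructor.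
  by move=> x; rewrite /translation /homothety; vec.
exists (rotation (2^-1 *: (v + v')) pi); first by constructor.
move=> x; rewrite /rotation cospi sinpi /homothety.
by apply: pt_eq; rewrite /= /GRing.scale /=; lra.
Qed.

(** * Relabelling the vertices of triangles and parallelograms *)

Lemma tri_swap a e f : tri a e f = tri a f e.
Proof.
by apply/seteqP; split => _ [s [t [s0 t0 st ->]]]; exists t, s;
  (split => //; [rewrite addrC|rewrite addrAC]).
Qed.

Lemma tri_rot a e f : tri a e f = tri (a + e) (- e) (f - e).
Proof.
apply/seteqP; split => _ [s [t [s0 t0 st ->]]]; exists (1 - s - t), t;
  (split; [lra|lra|lra|vec]).
Qed.

Lemma pgram_swap a e f : pgram a e f = pgram a f e.
Proof.
by apply/seteqP; split => _ [s [t [s0 t0 ->]]]; exists t, s; split; rewrite // addrAC.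
Qed.

Lemma pgram_opp a e f : pgram a e f = pgram (a + e) (- e) f.
Proof.
apply/seteqP; split => _ [s [t [s0 t0 ->]]]; exists (1 - s), t; (split; [lra|lra|vec]).
Qed.

(** Gram matrix of two edge vectors issuing from a vertex of an equilateral triangle of side [l]. *)
Definition equi (l : R) e f :=
  [/\ dot e e = l ^+ 2, dot f f = l ^+ 2 & dot e f = l ^+ 2 / 2].

Lemma dotxx_ge0 x : 0 <= dot x x.
Proof. by rewrite /dot -!expr2 addr_ge0 ?sqr_ge0. Qed.

Lemma elength_sqr x : elength x ^+ 2 = dot x x.
Proof. by rewrite sqr_sqrtr ?dotxx_ge0. Qed.

Lemma equi_swap l e f : equi l e f -> equi l f e.
Proof. by case=> ? ? ef; split => //; rewrite dotC. Qed.

Lemma equi_rot l e f : equi l e f -> equi l (- e) (f - e).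
Proof.
rewrite /equi /dot /= => -[ee ff ef]; split; lra.
Qed.

Lemma equilateral_triangleP T : equilateral_triangle T ->
  exists a e f l, [/\ 0 < l, equi l e f & T = tri a e f].
Proof.
move=> [a [b [c [l0 bc ca ->]]]]; exists a, (b - a), (c - a), (elength (b - a)).
split => //; last by rewrite hull3E.
have := elength_sqr (b - a); have := elength_sqr (c - b).
have := elength_sqr (a - c); rewrite bc ca /equi => h1 h2 h3.
rewrite h3; move: h1 h2 h3; move: (elength _) => l; rewrite /dot /= => h1 h2 h3.
by split; lra.
Qed.

Lemma equiP l e f : dot e e = l ^+ 2 -> dot f f = l ^+ 2 ->
  dot (f - e) (f - e) = l ^+ 2 -> equi l e f.
Proof. by rewrite /equi /dot /= => h1 h2 h3; split; lra. Qed.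

Lemma tri_side l a e f (r s : R * R) : equi l e f -> is_side (tri a e f) r s ->
  exists a' e' f', [/\ equi l e' f', tri a e f = tri a' e' f' &
    parallel (s - r) e'].
Proof.
move=> ef /is_side_tri[par|par|par].
- by exists a, e, f.
- by exists a, f, e; split; rewrite // 1?tri_swap //; apply: equi_swap.
- exists (a + e), (f - e), (- e); split; rewrite // 1?tri_rot 1?tri_swap //.
  exact/equi_swap/equi_rot.
Qed.

Lemma affine_tri g a e f : affine g ->
  g @` tri a e f = tri (g a) (g (a + e) - g a) (g (a + f) - g a).
Proof.
move=> ag; have E (b : R * R) : a + b - a = b by rewrite addrAC subrr add0r.
have := affine_hull3 a (a + e) (a + f) ag.
by rewrite !hull3E !E.
Qed.

Lemma rhombus_side alpha P (p q : R * R) : rhombus 1 alpha P -> is_side P p q ->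
  exists a e f, [/\ dot e e = 1, dot f f = 1, dot e f = cos alpha,
    P = pgram a e f & parallel (q - p) e].
Proof.
move=> [a [b [c [d [abcd [ab bc cd da] ang PE]]]]].
have ee : dot (b - a) (b - a) = 1 by rewrite -elength_sqr ab expr1n.
have ad : elength (d - a) = 1.
  by rewrite -da /elength; congr Num.sqrt; rewrite /dot /=; ring.
have ff : dot (d - a) (d - a) = 1 by rewrite -elength_sqr ad expr1n.
have ef : dot (b - a) (d - a) = cos alpha.
  rewrite -ang /angle ab ad mulr1 divr1 acosK // in_itv /=.
  move: ee ff; rewrite /dot; move: (b - a) (d - a) => e f ee ff.
  (* The squares of [e - f] and [e + f] place the scalar product in the domain where [acos] inverts
     [cos]. *)
  have h1 := sqr_ge0 (e.1 - f.1); have h2 := sqr_ge0 (e.2 - f.2).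
  have h3 := sqr_ge0 (e.1 + f.1); have h4 := sqr_ge0 (e.2 + f.2).
  by apply/andP; split; lra.
rewrite PE hull4E // => /is_side_pgram[par|par].
  by exists a, (b - a), (d - a).
by exists a, (d - a), (b - a); split; rewrite // 1?pgram_swap // dotC.
Qed.

End Geometry.

(** * Metric relations *)

Section Geometry.
Variable R : realType.
Implicit Types (x y z u e f v : R * R) (P T C : set (R * R)) (s t k l : R).

(** The side of the equilateral triangle of height [sin alpha]: the height of the rhombus measured
    along a slanted side of the triangle. *)
Definition rheight (alpha : R) : R := 2 * Num.sqrt 3 / 3 * sin alpha.

Lemma rheight_sqr alpha : rheight alpha ^+ 2 = 4 / 3 * (1 - cos alpha ^+ 2).
Proof.
rewrite /rheight -sin2cos2 exprMn expr_div_n exprMn sqr_sqrtr //.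
by rewrite [2 ^+ 2]expr2 [3 ^+ 2]expr2; field.
Qed.

(** Triple-angle formula at [pi / 6], where the cosine of the triple angle vanishes. *)
Lemma cos_pisixth : cos (pi / 6 : R) ^+ 2 = 3 / 4 /\ 0 < cos (pi / 6 : R).
Proof.
have c0 : 0 < cos (pi / 6 : R).
  by have := pi_gt0 R => pi0; apply: cos_gt0_pihalf; apply/andP; split; lra.
split => //.
have : cos (pi / 6 *+ 2 + pi / 6 : R) = 0.
  by rewrite -[RHS](cos_pihalf R); congr cos; lra.
rewrite cosD cos_mulr2n sin_mulr2n mulr2n.
have := sin2cos2 (pi / 6 : R); move: (cos _) (sin _) c0 => c d c0 hd h.
have : c * (4 * c ^+ 2 - 3) = 0.
  have -> : c * (4 * c ^+ 2 - 3) = (c ^+ 2 + c ^+ 2 - 1) * c - 2 * c * (1 - c ^+ 2).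
    by ring.
  by rewrite -hd; lra.
by move=> /eqP; rewrite mulf_eq0 gt_eqF //= => /eqP; lra.
Qed.

(** Doubling the angle gives cos (2 alpha) < - cos (pi / 6) < - 6 / 7, hence
    [cos alpha ^+ 2 <= 1 / 14], which suffices for the lower bound 10 / 9. *)
Lemma angle_bounds alpha : 5 * pi / 12 < alpha <= pi / 2 ->
  [/\ 0 < sin alpha, 0 <= cos alpha, 10 / 9 <= rheight alpha <= 7 / 6 &
      cos alpha <= rheight alpha / 2].
Proof.
move=> /andP[a1 a2]; have pi0 := pi_gt0 R.
have s0 : 0 < sin alpha by apply: sin_gt0_pi; apply/andP; split; lra.
have c0 : 0 <= cos alpha by apply: cos_ge0_pihalf; apply/andP; split; lra.
have H0 : 0 < rheight alpha.
  by rewrite /rheight !mulr_gt0 // ?invr_gt0 ?sqrtr_gt0; lra.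
have [h6 h60] := cos_pisixth.
have : cos (alpha *+ 2) < cos (pi - pi / 6).
  by rewrite ltr_cos ?in_itv /=; [|apply/andP; split|apply/andP; split]; lra.
rewrite cosB cospi sinpi mul0r addr0 mulN1r cos_mulr2n mulr2n.
have := rheight_sqr alpha.
move: (cos (pi / 6)) (cos alpha) (rheight alpha) h6 h60 c0 H0.
move=> c d H h6 h60 c0 H0 hH hc.
have c67 : 6 / 7 < c by rewrite ltNge; apply/negP => h; nra.
have d2 : d ^+ 2 <= 1 / 14 by lra.
split => //; last by nra.
by have := sqr_ge0 d => d0; apply/andP; split; nra.
Qed.

Definition det x y : R := x.1 * y.2 - x.2 * y.1.

(** Lagrange's identity. *)
Lemma det_sqr x y : det x y ^+ 2 = dot x x * dot y y - dot x y ^+ 2.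
Proof. by rewrite /det /dot; ring. Qed.

Lemma det_parallel x y : parallel x y -> det x y = 0.
Proof. by rewrite /det => ->; rewrite subrr. Qed.

Lemma parallel_unit x y : dot x x = 1 -> dot y y = 1 -> parallel x y ->
  y = x \/ y = - x.
Proof.
move=> xx yy /det_parallel d0; have := det_sqr x y.
rewrite d0 xx yy => h.
have : (dot x y - 1) * (dot x y + 1) = 0 by lra.
have zero (z : R * R) : dot z z = 0 -> z = 0.
  rewrite /dot -!expr2 => /eqP; rewrite paddr_eq0 ?sqr_ge0 // !sqrf_eq0.
  by move=> /andP[/eqP ? /eqP ?]; apply: pt_eq.
move=> /eqP; rewrite mulf_eq0 => /orP[] /eqP hd; [left|right].
  apply/eqP; rewrite -subr_eq0; apply/eqP/zero.
  by move: xx yy hd; rewrite /dot /=; lra.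
apply/eqP; rewrite -subr_eq0 opprK; apply/eqP/zero.
by move: xx yy hd; rewrite /dot /=; lra.
Qed.

Lemma parallel_trans x y z : x <> 0 -> parallel x y -> parallel x z -> parallel y z.
Proof.
move=> x0 xy xz; apply: (@parallel_orthogonal _ (- x.2, x.1)).
- by move=> [/eqP]; rewrite oppr_eq0 => /eqP h2 h1; apply: x0; apply: pt_eq.
- by move: xy; rewrite /parallel /dot /=; lra.
- by move: xz; rewrite /parallel /dot /=; lra.
Qed.

Lemma equi_scale k l e f : equi l e f -> equi (k * l) (k *: e) (k *: f).
Proof.
move=> [ee ff ef].
by split; rewrite dotZ dotC dotZ 1?[dot f e]dotC ?ee ?ff ?ef; ring.
Qed.

(** Write [h] as [p *: e + q *: f]; then [q] is the height up to sign. A negative [q] is repaired by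
    starting from the opposite side, and then a negative scalar product with [e] by passing to the
    frame [- e], [f - e]. The result is [k = 1 / 2 - cos alpha / rheight alpha]. *)
Lemma pgram_frame alpha P e f A h : 0 <= cos alpha <= rheight alpha / 2 ->
  0 < rheight alpha -> equi 1 e f -> dot h h = 1 -> `|dot e h| = cos alpha ->
  P = pgram A e h ->
  exists A' k e' f', [/\ 0 <= k <= 1 / 2,
    P = pgram A' e' (rheight alpha *: f' - (k * rheight alpha) *: e') &
    (e' = e /\ f' = f) \/ (e' = - e /\ f' = f - e)].
Proof.
move=> /andP[c0 cH] H0 [ee ff ef] hh ehc PE.
have D2 : det e f ^+ 2 = 3 / 4 by rewrite det_sqr ee ff ef; lra.
have D0 : det e f != 0.
  by apply: contraTneq isT => D0; move: D2; rewrite D0; lra.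
pose q := det e h / det e f; pose p := det h f / det e f.
have hE : h = p *: e + q *: f.
  move: D0; rewrite /p /q /det => D0.
  by apply: pt_eq; rewrite /= /GRing.scale /=; field.
have pq : dot e h = p + q / 2 by rewrite hE dotD !dotZ ee ef; lra.
have : q ^+ 2 = rheight alpha ^+ 2.
  rewrite rheight_sqr /q expr_div_n det_sqr D2 ee hh -ehc real_normK ?num_real //.
  by field.
move=> /eqP; rewrite eqf_sqr => qH.
have {pq} : exists p q s A', [/\ P = pgram A' e (p *: e + q *: f),
    q = rheight alpha, s = p + q / 2 & `|s| = cos alpha].
  case/orP: qH => /eqP qH.
    by exists p, q, (dot e h), A; split; rewrite // -hE.
  exists (- p), (- q), (- dot e h), (A + h); split.
  - rewrite PE pgram_swap pgram_opp pgram_swap hE; congr pgram.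
    by apply: pt_eq; rewrite /= /GRing.scale /=; ring.
  - by rewrite qH opprK.
  - by rewrite pq; lra.
  - by rewrite normrN.
move: (rheight alpha) H0 cH => H H0 cH.
move=> {p q qH hE PE A} [p [q [s [A [PE qH sE sc]]]]].
have HN0 : H != 0 by rewrite gt_eqF.
have kb (c : R) : 0 <= c <= H / 2 -> 0 <= 1 / 2 - c / H <= 1 / 2.
  move=> /andP[h1 h2]; have : c / H <= 1 / 2 by rewrite ler_pdivrMr //; lra.
  have : 0 <= c / H by rewrite divr_ge0 // ltW.
  by move=> *; apply/andP; split; lra.
case: (lerP 0 s) => s0.
  exists A, (1 / 2 - s / H), e, f; split; last by left.
    by apply: kb; move: sc; rewrite ger0_norm // => ->; rewrite c0.
  rewrite PE qH; congr pgram; rewrite addrC; congr (_ + _).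
  by rewrite -scaleNr; congr (_ *: _); rewrite sE qH; field.
exists (A + e), (1 / 2 - (- s) / H), (- e), (f - e); split; last by right.
  by apply: kb; move: sc; rewrite ltr0_norm // => ->; rewrite c0.
rewrite PE pgram_opp qH; congr pgram.
have -> : p = s - H / 2 by rewrite sE qH; lra.
by apply: pt_eq; rewrite /= /GRing.scale /=; field.
Qed.

(** The unit frame comes from the triangle; when [pgram_frame] changes it, the triangle is
    relabelled accordingly, so that [P] and [T] share [e] and [f]. *)
Lemma frame alpha P T : 5 * pi / 12 < alpha <= pi / 2 ->
  rhombus 1 alpha P -> equilateral_triangle T ->
  (exists p q r s : R * R,
       [/\ is_side P p q, is_side T r s & parallel (s - r) (q - p)]) ->
  exists A k e f a l, [/\ 0 <= k <= 1 / 2, 0 < l, equi 1 e f,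
    P = pgram A e (rheight alpha *: f - (k * rheight alpha) *: e) &
    T = tri a (l *: e) (l *: f)].
Proof.
move=> ha hP hT [p [q [r [s [sP sT par]]]]].
have [s0 c0 /andP[H0 H1] cH] := angle_bounds ha.
have [a0 [e0 [f0 [l [l0 ef0 TE0]]]]] := equilateral_triangleP hT.
have [a [e [f [ef TE parT]]]] : exists a e f, [/\ equi l e f, T = tri a e f &
    parallel (s - r) e] by rewrite TE0 in sT *; apply: tri_side ef0 sT.
have [A [g [h [gg hh gh PE parP]]]] := rhombus_side hP sP.
have lN0 : l != 0 by rewrite gt_eqF.
have ef1 := equi_scale l^-1 ef; rewrite mulVf // in ef1.
have eg : parallel (l^-1 *: e) g.
  have pq0 : q - p <> 0.
    by case: sP => pq _ /eqP; rewrite subr_eq0 => /eqP/esym.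
  have rs0 : s - r <> 0.
    by case: sT => rs _ /eqP; rewrite subr_eq0 => /eqP/esym.
  have : parallel e g.
    by apply: (parallel_trans pq0 _ parP); apply: (parallel_trans rs0).
  by rewrite /parallel /= /GRing.scale /= -!mulrA => ->.
have [A' PE' dc] : exists2 A', P = pgram A' (l^-1 *: e) h &
    `|dot (l^-1 *: e) h| = cos alpha.
  have [] := ef1; rewrite expr1n => ee _ _.
  have [ge|ge] := parallel_unit ee gg eg.
    by exists A; rewrite -ge // gh ger0_norm.
  exists (A + g); first by rewrite PE pgram_opp ge opprK.
  have -> : l^-1 *: e = - g by rewrite ge opprK.
  by rewrite dotC -scaleN1r dotZ dotC gh mulN1r normrN ger0_norm.
have [||A2 [k [e' [f' [hk PE2 ef']]]]] := pgram_frame _ _ ef1 hh dc PE'.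
- by rewrite c0.
- by lra.
have eE : e = l *: (l^-1 *: e) by rewrite scalerA divff // scale1r.
have fE : f = l *: (l^-1 *: f) by rewrite scalerA divff // scale1r.
case: ef' => -[e'E f'E].
  by exists A2, k, e', f', a, l; split; rewrite // e'E f'E // -eE -fE.
exists A2, k, e', f', (a + e), l; split; rewrite // e'E f'E.
  exact: equi_rot.
by rewrite TE tri_rot scalerN scalerBr -eE -fE.
Qed.

(** At relative height t the triangle has width l (1 - t). The two sides along [g] have length 1 and
    their relative heights differ by H / l, so the higher one forces 1 <= l (1 - H / l). *)
Lemma tri_contains_pgram alpha a e f l A g h : 0 <= rheight alpha ->
  0 < l -> equi l e f -> dot g g = 1 -> dot h h = 1 ->
  dot g h ^+ 2 = cos alpha ^+ 2 -> parallel e g ->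
  pgram A g h `<=` tri a e f -> 1 + rheight alpha <= l.
Proof.
move=> H0 l0 [ee ff ef] gg hh gh /det_parallel eg sub.
have lN0 : l != 0 by rewrite gt_eqF.
have D2 : det e f ^+ 2 = 3 / 4 * l ^+ 4.
  by rewrite det_sqr ee ff ef; field.
have D0 : det e f != 0 by rewrite -sqrf_eq0 D2 mulf_neq0 ?expf_neq0 //; lra.
have coord X : tri a e f X -> exists s t, [/\ 0 <= s, 0 <= t, s + t <= 1,
    det e (X - a) = t * det e f & det (X - a) f = s * det e f].
  move=> [s [t [s0 t0 st ->]]]; exists s, t; split => //.
    by rewrite /det /= /GRing.scale /=; ring.
  by rewrite /det /= /GRing.scale /=; ring.
have corner (s t : R) : 0 <= s <= 1 -> 0 <= t <= 1 -> tri a e f (A + s *: g + t *: h).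
  by move=> ? ?; apply: sub; exists s, t.
have h00 : 0 <= (0 : R) <= 1 by lra.
have h11 : 0 <= (1 : R) <= 1 by lra.
(* The orientations of [g] and [h] are unknown, so these ratios are determined only up to sign. *)
have gD : (det g f / det e f) ^+ 2 = l^-1 ^+ 2.
  have : det g f * dot e e = det e f * dot e g + det e g * (- dot e f).
    by rewrite /det /dot; ring.
  rewrite eg mul0r addr0 ee => gf.
  have : dot e g ^+ 2 = l ^+ 2.
    by rewrite -[RHS]mulr1 -gg -ee -[RHS]subr0 -[0](expr0n R 2) -eg det_sqr; ring.
  have -> : det g f = det e f * dot e g / l ^+ 2 by rewrite -gf mulfK // expf_neq0.
  move=> eg2; transitivity (dot e g ^+ 2 / l ^+ 4); first by field; rewrite lN0.
  by rewrite eg2; field.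
have hD : (det e h / det e f) ^+ 2 = (rheight alpha / l) ^+ 2.
  have : (det e h) ^+ 2 = l ^+ 2 * (1 - cos alpha ^+ 2).
    rewrite -gh -[1]mulr1 -{1}gg -hh -det_sqr.
    have : det e h * dot g g = dot e g * det g h + det e g * dot g h.
      by rewrite /det /dot; ring.
    rewrite eg mul0r addr0 gg mulr1 => ->; rewrite exprMn; congr (_ * _).
    by rewrite -[RHS]mulr1 -gg -ee -[RHS]subr0 -[0](expr0n R 2) -eg det_sqr; ring.
  by move=> eh; rewrite !expr_div_n rheight_sqr D2 eh; field.
have row (t : R) : 0 <= t <= 1 -> l^-1 <= 1 - (det e (A + t *: h - a)) / det e f.
  move=> ht; have [s1 [t1 [s10 t10 st1 t1E s1E]]] := coord _ (corner _ _ h00 ht).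
  have [s2 [t2 [s20 t20 st2 t2E s2E]]] := coord _ (corner _ _ h11 ht).
  rewrite scale0r addr0 in t1E s1E.
  have t12 : t2 = t1.
    apply: (mulIf D0); rewrite -t1E -t2E; move: eg.
    by rewrite /det /= /GRing.scale /=; lra.
  have s12 : s2 - s1 = det g f / det e f.
    apply: (mulIf D0); rewrite mulrBl -s1E -s2E divfK //.
    by rewrite /det /= /GRing.scale /=; ring.
  rewrite t1E mulfK //; have : 0 <= l^-1 by rewrite invr_ge0 ltW.
  by move: gD; rewrite -s12 => /eqP; rewrite eqf_sqr => /orP[] /eqP *; lra.
have r0 := row _ h00; have r1 := row _ h11.
have t0 (t : R) : 0 <= t <= 1 -> 0 <= det e (A + t *: h - a) / det e f.
  move=> ht; have [s1 [t1 [s10 t10 st1 t1E s1E]]] := coord _ (corner _ _ h00 ht).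
  by rewrite scale0r addr0 in t1E; rewrite t1E mulfK.
have t00 := t0 _ h00; have t01 := t0 _ h11.
have diff : det e (A + 1 *: h - a) / det e f =
    det e (A + 0 *: h - a) / det e f + det e h / det e f.
  by rewrite -mulrDl; congr (_ / _); rewrite /det /= /GRing.scale /=; ring.
have : l^-1 <= 1 - rheight alpha / l.
  have : 0 <= rheight alpha / l by rewrite divr_ge0 // ltW.
  by move: hD => /eqP; rewrite eqf_sqr => /orP[] /eqP *; lra.
rewrite -(ler_pM2r l0) mulVf // mulrBl divfK //; lra.
Qed.
End Geometry.

(** * Areas *)

Section Area.
Variable R : realType.
Implicit Types (x y z u e f v : R * R) (P T C : set (R * R)) (s t k l : R).

Lemma integral_affine (p q c d : R) : p < q ->
  (\int[lebesgue_measure]_(x in `[p, q]) (c * (x - d))%:E =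
   (c / 2 * ((q - d) ^+ 2 - (p - d) ^+ 2))%:E)%E.
Proof.
move=> pq; pose F := fun x : R => c / 2 * (x - d) ^+ 2.
have dF (x : R) : is_derive x 1 F (c * (x - d)).
  rewrite /F; apply: is_derive_eq; rewrite /GRing.scale /=; lra.
have cF : continuous F.
  move=> y; apply: differentiable_continuous; apply/derivable1_diffP.
  by have [] := dF y.
rewrite (@continuous_FTC2 _ (fun x : R => c * (x - d)) F) //.
- by rewrite -EFinB /F mulrBr.
- apply: continuous_subspaceT => y.
  by apply: cvgM; [exact: cvg_cst|apply: cvgB; [exact: cvg_id|exact: cvg_cst]].
- split=> [y _| |]; first by have [] := dF y.
  + by apply: cvg_at_right_filter; apply: cF.
  + by apply: cvg_at_left_filter; apply: cF.
- by move=> y _; rewrite derive1E derive_val.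
Qed.

(* [R] has several measurable structures; [area] is a measure for this one. *)
Definition borel P := @measurable _ (measurableTypeR R * measurableTypeR R)%type P.

Lemma borel_halfplane u (c : R) :
  borel [set x : R * R | dot u x <= c].
Proof.
have mf : @measurable_fun _ _ (measurableTypeR R * measurableTypeR R)%type
    (measurableTypeR R) setT (dot u).
  apply: measurable_funD; apply: measurable_funM.
  - exact: measurable_cst.
  - exact: measurable_fst.
  - exact: measurable_cst.
  - exact: measurable_snd.
have := mf measurableT `]-oo, c]%classic (measurable_itv _).
rewrite setTI; congr borel; apply/seteqP; split=> x /=; by rewrite in_itv.
Qed.

Lemma area_line u (c : R) : u <> 0 -> area [set x : R * R | dot u x = c] = 0%E.
Proof.
move=> u0; rewrite /area.
have [u2|u2] := eqVneq u.2 0.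
  have u1 : u.1 != 0.
    by apply/eqP => u1; apply: u0; apply: pt_eq.
  have -> : [set x : R * R | dot u x = c] = [set c / u.1] `*` setT.
    apply/seteqP; split=> -[x1 x2] /=; rewrite /dot /= u2 mul0r addr0.
      by move=> <-; rewrite mulrAC divff ?mul1r.
    by move=> [-> _]; rewrite mulrC divfK.
  rewrite product_measure1E // [X in (X * _)%E](_ : _ = 0%E) ?mul0e //.
  exact: lebesgue_measure_set1.
rewrite /product_measure1 integral0_eq // => x _ /=.
rewrite [X in lebesgue_measure X](_ : _ = [set (c - u.1 * x) / u.2]).
  exact: lebesgue_measure_set1.
apply/seteqP; split=> y; rewrite xsectionE /= /dot /=.
  by move=> <-; rewrite addrAC subrr add0r mulrAC divff ?mul1r.
by move=> ->; rewrite [u.2 * _]mulrC divfK // addrC subrK.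
Qed.

Lemma areaU P T (p q : R) : borel P -> borel T ->
  area P = p%:E -> area T = q%:E -> area (P `&` T) = 0%E ->
  area (P `|` T) = (p + q)%:E.
Proof.
rewrite /area => mP mT aP aT PT0.
have fin : ((lebesgue_measure \x lebesgue_measure) P < +oo)%E by rewrite aP ltry.
apply: etrans (measureUfinl mP mT fin) _.
by rewrite [X in (_ - X)%E]PT0 sube0; apply: (congr2 adde aP aT).
Qed.

(** Cramer's rule recovers the coordinates along [e] and [f]. *)
Lemma tri_halfplanes a e f : det e f != 0 -> tri a e f =
  [set x | [/\ 0 <= det (x - a) f / det e f, 0 <= det e (x - a) / det e f &
    det (x - a) f / det e f + det e (x - a) / det e f <= 1]].
Proof.
move=> D0; apply/seteqP; split=> x.
  move=> [s [t [s0 t0 st ->]]] /=.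
  have -> : det (a + s *: e + t *: f - a) f / det e f = s.
    apply: (mulIf D0); rewrite divfK //.
    by rewrite /det /= /GRing.scale /=; ring.
  have -> // : det e (a + s *: e + t *: f - a) / det e f = t.
  apply: (mulIf D0); rewrite divfK //.
  by rewrite /det /= /GRing.scale /=; ring.
move=> [s0 t0 st]; exists (det (x - a) f / det e f), (det e (x - a) / det e f).
split => //; move: D0; rewrite /det => D0.
by apply: pt_eq; rewrite /= /GRing.scale /=; field.
Qed.

Lemma borel_tri a e f : det e f != 0 -> borel (tri a e f).
Proof.
move=> D0; rewrite tri_halfplanes //.
pose u : R * R := (- f.2 / det e f, f.1 / det e f).
pose v : R * R := (e.2 / det e f, - e.1 / det e f).
rewrite (_ : [set x | _] = [set x | dot u x <= dot u a] `&`
  [set x | dot v x <= dot v a] `&`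
  [set x | dot (- (u + v)) x <= 1 + dot (- (u + v)) a]).
  by apply: measurableI; [apply: measurableI|]; exact: borel_halfplane.
have E x : det (x - a) f / det e f = dot u a - dot u x /\
           det e (x - a) / det e f = dot v a - dot v x.
  by rewrite /u /v /dot /det /=; split; ring.
have E3 x : dot (- (u + v)) x = - dot u x - dot v x by rewrite /dot /=; ring.
apply/seteqP; split=> x /=; have [-> ->] := E x; rewrite !E3; move: (E3 a) => ?.
  by move=> [? ? ?]; split; [split|]; lra.
by move=> [[? ?] ?]; split; lra.
Qed.

(* The section of the triangle at abscissa a.1 + r e.1 runs from a.2 + r e.2 to
   a.2 + r f.2. *)
Lemma area_tri_vertical a e f : e.1 = f.1 -> e.1 != 0 -> e.2 < f.2 ->
  area (tri a e f) = (`|det e f| / 2)%:E.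
Proof.
move=> ef e0 ef2; pose w := e.1; pose p := Num.min a.1 (a.1 + w).
pose q := Num.max a.1 (a.1 + w).
have wpq : (0 < w /\ p = a.1 /\ q = a.1 + w) \/ (w < 0 /\ p = a.1 + w /\ q = a.1).
  rewrite /p /q; have [w0|w0] := ltrP 0 w; [left|right].
    by rewrite min_l ?max_r //; lra.
  have {}w0 : w < 0 by rewrite lt_neqAle e0.
  by rewrite min_r ?max_l //; lra.
have pq : p < q by case: wpq => -[? [-> ->]]; lra.
have secE (x : R) : (lebesgue_measure (xsection (tri a e f) x) =
    ((fun x : R => ((f.2 - e.2) / w * (x - a.1))%:E) \_ `[p, q]) x)%E.
  pose r := (x - a.1) / w; have xE : x = a.1 + r * w by rewrite divfK // addrC subrK.
  have rE : (x \in `[p, q]) = (0 <= r <= 1).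
    rewrite in_itv /= /r; case: wpq => -[w0 [-> ->]].
      rewrite ler_pdivlMr // ler_pdivrMr // mul0r mul1r.
      by apply/andP/andP => -[? ?]; split; lra.
    rewrite ler_ndivlMr // ler_ndivrMr // mul0r mul1r.
    by apply/andP/andP => -[? ?]; split; lra.
  have triE (y : R) : tri a e f (x, y) <->
    [/\ 0 <= r <= 1, a.2 + r * e.2 <= y & y <= a.2 + r * f.2].
    split=> [[s [t [s0 t0 st [x1 y1]]]]|[r01 y1 y2]].
      have -> : r = s + t.
        rewrite /r x1 /GRing.scale /= -ef -/w; field; exact: e0.
      rewrite y1 /GRing.scale /=; split; first (by lra); nra.
    have ef0 : 0 < f.2 - e.2 by lra.
    pose t := (y - a.2 - r * e.2) / (f.2 - e.2).
    have tE : t * (f.2 - e.2) = y - a.2 - r * e.2 by rewrite divfK // gt_eqF.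
    exists (r - t), t; split.
    - by rewrite subr_ge0 -(ler_pM2r ef0) tE; lra.
    - by rewrite -(ler_pM2r ef0) tE; lra.
    - by lra.
    - apply: pt_eq; rewrite /= /GRing.scale /= -?ef -/w; last by lra.
      by rewrite {1}xE; ring.
  rewrite patchE mem_setE rE; case: ifPn => xr.
    rewrite [X in lebesgue_measure X](_ : _ =
        `[a.2 + r * e.2, a.2 + r * f.2]%classic).
      have r0 : 0 <= r by case/andP: xr.
      rewrite lebesgue_measure_itv /= lte_fin.
      have fE : (f.2 - e.2) / w * (x - a.1) = a.2 + r * f.2 - (a.2 + r * e.2).
        by rewrite /r; ring.
      case: ltrP => h; first by rewrite -EFinB fE.
      by congr EFin; rewrite fE; nra.
    apply/seteqP; split=> y; rewrite xsectionE /= in_itv /=.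
      by move=> /triE[_ -> ->].
    by move=> /andP[? ?]; apply/triE.
  rewrite [X in lebesgue_measure X](_ : _ = set0) ?measure0 //.
  by apply/seteqP; split=> y //; rewrite xsectionE => /triE[/(negP xr)].
transitivity (\int[lebesgue_measure]_x
    (((fun x : R => ((f.2 - e.2) / w * (x - a.1))%:E) \_ `[p, q]) x))%E.
  by apply: eq_integral => x _; exact: secE.
rewrite -integral_mkcond integral_affine //; congr EFin.
have -> : det e f = w * (f.2 - e.2) by rewrite /det -ef -/w; ring.
rewrite normrM [`|f.2 - e.2|]gtr0_norm ?subr_gt0 //.
case: wpq => -[w0 [-> ->]]; [rewrite gtr0_norm //|rewrite ltr0_norm //].
  by field; rewrite gt_eqF.
by field; rewrite lt_eqF.
Qed.

(** * Areas by dissection *)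

Lemma dotNl u x : dot (- u) x = - dot u x.
Proof. by rewrite /dot /=; ring. Qed.

(** The two pieces overlap only within a line, which is a null set. *)
Lemma area_union_across_line P P1 P2 u (c p q : R) : u <> 0 ->
  borel P1 -> borel P2 -> area P1 = p%:E -> area P2 = q%:E ->
  P = P1 `|` P2 -> P1 `<=` [set x | dot u x <= c] -> P2 `<=` [set x | c <= dot u x] ->
  area P = (p + q)%:E.
Proof.
move=> u0 m1 m2 a1 a2 -> h1 h2; apply: areaU => //.
apply/eqP; rewrite eq_le; apply/andP; split; last first.
  by rewrite /area; apply: integral_ge0.
rewrite -(area_line c u0); apply: le_measure; rewrite ?inE.
- exact: measurableI.
- have := measurableI _ _ (borel_halfplane u c) (borel_halfplane (- u) (- c)).
  congr borel; apply/seteqP; split=> x /=; rewrite dotNl lerN2.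
    by move=> [? ?]; apply/eqP; rewrite eq_le; apply/andP.
  by move=> ->.
- by move=> x [/h1 /= ? /h2 /= ?]; apply/eqP; rewrite eq_le; apply/andP.
Qed.

Lemma det_swap e f : det f e = - det e f.
Proof. by rewrite /det; ring. Qed.

Lemma det_rot e f : det (- e) (f - e) = - det e f.
Proof. by rewrite /det /=; ring. Qed.

Definition area_formula a e f := area (tri a e f) = (`|det e f| / 2)%:E.

Lemma area_formula_swap a e f : area_formula a f e -> area_formula a e f.
Proof. by rewrite /area_formula tri_swap det_swap normrN. Qed.

Lemma area_formula_rot a e f : area_formula (a + e) (- e) (f - e) -> area_formula a e f.
Proof. by rewrite /area_formula -tri_rot det_rot normrN. Qed.

Lemma area_formula_vertical a e f : e.1 = f.1 -> det e f != 0 -> area_formula a e f.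
Proof.
move=> ef D0; have e0 : e.1 != 0.
  by apply: contraNneq D0 => e0; rewrite /det -ef e0; apply/eqP; ring.
have [h|h|h] := ltgtP e.2 f.2.
- exact: area_tri_vertical.
- by apply: area_formula_swap; apply: area_tri_vertical; rewrite -?ef.
- by move: D0; rewrite /det ef h mulrC subrr eqxx.
Qed.

(** The vertical line through the middle vertex [a + e] meets the opposite edge at [a + l *: f] and
    cuts the triangle into two triangles with a vertical edge. *)
Lemma area_formula_ordered a e f : 0 <= e.1 -> e.1 <= f.1 -> det e f != 0 ->
  area_formula a e f.
Proof.
move=> e0 ef D0; have [ef1|ef1] := eqVneq e.1 f.1.
  exact: area_formula_vertical.
have [e1|e1] := eqVneq e.1 0.
  apply/area_formula_swap/area_formula_rot/area_formula_vertical.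
    by rewrite /= e1 add0r.
  by rewrite det_rot det_swap opprK.
have {}e0 : 0 < e.1 by rewrite lt_neqAle eq_sym e1.
have {}ef : e.1 < f.1 by rewrite lt_neqAle ef1.
pose l := e.1 / f.1; have f0 : 0 < f.1 by apply: lt_trans ef.
have l0 : 0 < l by rewrite divr_gt0.
have l1 : l < 1 by rewrite ltr_pdivrMr // mul1r.
have lN0 : l != 0 by rewrite gt_eqF.
have l1N0 : 1 - l != 0 by rewrite subr_eq0 gt_eqF.
have D1 : det e (l *: f) = l * det e f.
  by rewrite /det /= /GRing.scale /=; ring.
have D2 : det (e - f) (- (1 - l) *: f) = - (1 - l) * det e f.
  by rewrite /det /= /GRing.scale /=; ring.
have v1 : e.1 = (l *: f).1 by rewrite /= /GRing.scale /= divfK // gt_eqF.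
have v2 : (e - f).1 = (- (1 - l) *: f).1.
  by rewrite [in RHS]/= /GRing.scale /= mulNr mulrBl mul1r opprB -[l * f.1]v1.
have D1N0 : det e (l *: f) != 0 by rewrite D1 mulf_neq0.
have D2N0 : det (e - f) (- (1 - l) *: f) != 0 by rewrite D2 mulf_neq0 // oppr_eq0.
clearbody l; have T1 := area_formula_vertical a v1 D1N0.
have T2 := area_formula_vertical (a + f) v2 D2N0.
(* Up to a constant, [dot u] is [l * s + t] in the coordinates [s], [t] of the triangle; it equals
   [c] on the cutting line. *)
pose u : R * R := ((l * f.2 - e.2) / det e f, (e.1 - l * f.1) / det e f).
pose c := dot u (a + e).
have uE s t : dot u (a + s *: e + t *: f) = dot u a + l * s + t.
  move: D0; rewrite /u /dot /det /= /GRing.scale /= => D0; field; exact: D0.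
have cE : c = dot u a + l by have := uE 1 0; rewrite scale1r scale0r !addr0 mulr1.
have u0 : u <> 0.
  move=> u0; move: cE (uE 1 0); rewrite /c u0 /dot /= !mul0r !add0r => l00.
  by move: l0; rewrite -l00 ltxx.
rewrite /area_formula.
have -> : `|det e f| / 2 =
    `|det e (l *: f)| / 2 + `|det (e - f) (- (1 - l) *: f)| / 2.
  rewrite D1 D2 [`|l * _|]normrM [`|_ * det e f|]normrM normrN.
  by rewrite (gtr0_norm l0) [`|1 - l|]gtr0_norm ?subr_gt0 //; lra.
apply: (@area_union_across_line _ _ _ u c _ _ u0 _ _ T1 T2).
- exact: borel_tri.
- exact: borel_tri.
- apply/seteqP; split=> x.
    move=> [s [t [s0 t0 st ->]]].
    have [h|h] := lerP t (l * (1 - s)).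
      left; exists s, (t / l); split => //.
      + by rewrite divr_ge0 // ltW.
      + have : t / l <= 1 - s by rewrite ler_pdivrMr // mulrC.
        by lra.
      + by rewrite scalerA divfK.
    right; exists s, ((1 - s - t) / (1 - l)); split => //.
    + by apply: divr_ge0; lra.
    + have : (1 - s - t) / (1 - l) <= 1 - s.
        by rewrite ler_pdivrMr ?subr_gt0 //; lra.
      by lra.
    + by apply: pt_eq; rewrite /= /GRing.scale /=; field.
  move=> [|] [s [t [s0 t0 st ->]]].
    exists s, (t * l); split => //.
    + by rewrite mulr_ge0 // ltW.
    + have : t * l <= t * 1 by rewrite ler_wpM2l // ltW.
      by lra.
    + by rewrite scalerA.
  exists s, (1 - s - t * (1 - l)); split => //.
  + have : t * (1 - l) <= t * 1 by rewrite ler_wpM2l //; lra.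
    by lra.
  + have : 0 <= t * (1 - l) by rewrite mulr_ge0 // subr_ge0 ltW.
    by lra.
  + by apply: pt_eq; rewrite /= /GRing.scale /=; ring.
- move=> _ [s [t [s0 t0 st ->]]] /=; rewrite scalerA uE cE.
  have : l * (s + t) <= l * 1 by rewrite ler_wpM2l // ltW.
  by lra.
- move=> _ [s [t [s0 t0 st ->]]] /=.
  have -> : a + f + s *: (e - f) + t *: (- (1 - l) *: f) =
      a + s *: e + (1 - s - t * (1 - l)) *: f.
    by apply: pt_eq; rewrite /= /GRing.scale /=; ring.
  rewrite uE cE; have : 0 <= (1 - l) * (1 - s - t) by rewrite mulr_ge0; lra.
  by lra.
Qed.

(** Relabelling puts the leftmost vertex first and orders the other two by abscissa. *)
Lemma area_tri a e f : det e f != 0 -> area (tri a e f) = (`|det e f| / 2)%:E.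
Proof.
have swp (g h : R * R) : det g h != 0 -> det h g != 0.
  by rewrite det_swap oppr_eq0.
have rot (g h : R * R) : det g h != 0 -> det (- g) (h - g) != 0.
  by rewrite det_rot oppr_eq0.
rewrite -/(area_formula a e f) => D0.
have [h1|h1] := lerP 0 e.1; have [h2|h2] := lerP 0 f.1.
- have [h3|h3] := lerP e.1 f.1; first exact: area_formula_ordered.
  by apply/area_formula_swap/area_formula_ordered; [|exact: ltW|exact: swp].
- apply/area_formula_swap/area_formula_rot/area_formula_ordered => /=; try lra.
  exact/rot/swp.
- apply/area_formula_rot/area_formula_ordered => /=; try lra.
  exact/rot.
- have [h3|h3] := lerP e.1 f.1.
    apply/area_formula_rot/area_formula_swap/area_formula_ordered => /=; try lra.
    exact/swp/rot.
  apply/area_formula_swap/area_formula_rot/area_formula_swap.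
  apply: area_formula_ordered => /=; try lra.
  exact/swp/rot/swp.
Qed.

(** The diagonal [s + t = 1] cuts off two triangles that are exchanged by a point reflection. *)
Lemma area_pgram a e f : det e f != 0 -> area (pgram a e f) = `|det e f|%:E.
Proof.
move=> D0; have D1 : det (- e) (- f) = det e f by rewrite /det /=; ring.
have D1N0 : det (- e) (- f) != 0 by rewrite D1.
have T1 := area_tri a D0; have T2 := area_tri (a + e + f) D1N0.
pose u : R * R := ((f.2 - e.2) / det e f, (e.1 - f.1) / det e f).
have uE s t : dot u (a + s *: e + t *: f) = dot u a + s + t.
  move: D0; rewrite /u /dot /det /= /GRing.scale /= => D0; field; exact: D0.
have u0 : u <> 0.
  by move=> u0; move: (uE 1 0); rewrite u0 /dot /= !mul0r; lra.
have -> : `|det e f| = `|det e f| / 2 + `|det (- e) (- f)| / 2 by rewrite D1; lra.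
have refl s t : a + e + f + s *: - e + t *: - f = a + (1 - s) *: e + (1 - t) *: f.
  by apply: pt_eq; rewrite /= /GRing.scale /=; ring.
apply: (@area_union_across_line _ _ _ u (dot u a + 1) _ _ u0 _ _ T1 T2).
- exact: borel_tri.
- exact: borel_tri.
- apply/seteqP; split=> x.
    move=> [s [t [/andP[s0 s1] /andP[t0 t1] ->]]].
    have [h|h] := lerP (s + t) 1; first by left; exists s, t.
    right; exists (1 - s), (1 - t); split; [lra|lra|lra|].
    by rewrite refl !opprB !addrA ![1 + _]addrC !addrK.
  move=> [|] [s [t [s0 t0 st ->]]].
    by exists s, t; split => //; apply/andP; split; lra.
  exists (1 - s), (1 - t); rewrite refl.
  by split => //; apply/andP; split; lra.
- by move=> _ [s [t [s0 t0 st ->]]] /=; rewrite uE; lra.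
- by move=> _ [s [t [s0 t0 st ->]]] /=; rewrite refl uE; lra.
Qed.
End Area.

(** * Finite subfamilies *)

Section FiniteSubfamilies.
Variable R : realType.
Implicit Types (a : nat -> R) (il : seq nat) (I : set nat).

(** Turns the recursive covering into positions indexed by the family; distinct indices ensure that
    no position is overwritten. *)
Lemma covers_placement a il (A : R * R -> Prop) :
  covers [seq a i | i <- il] A -> uniq il ->
  exists (up : nat -> bool) (c : nat -> R * R), forall p, A p ->
    exists2 i, i \in il & tile (up i) (a i) (c i) p.
Proof.
elim: il A => [|i il IH] A /=.
  by move=> A0 _; exists xpredT, (fun=> 0) => p /A0.
move=> [u [x cA]] /andP[iil uil]; have [up [c h]] := IH _ cA uil.
exists (fun j => if j == i then u else up j), (fun j => if j == i then x else c j).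
move=> p Ap; have [tp|ntp] := boolP (tile u (a i) x p).
  by exists i; rewrite ?mem_head // eqxx.
have [j jil tj] := h p (conj Ap ntp); exists j; first by rewrite inE jil orbT.
by case: eqP => // ji; rewrite -ji jil in iil.
Qed.

Lemma bounded_away il a (s m : R) : m < s -> (forall i, i \in il -> a i < s) ->
  exists m', [/\ m <= m', m' < s & forall i, i \in il -> a i <= m'].
Proof.
move=> ms; elim: il => [|i il IH] hil; first by exists m.
have [|m' [mm' m's hm']] := IH.
  by move=> j jil; apply: hil; rewrite inE jil orbT.
exists (Num.max m' (a i)); split; first by rewrite le_max mm'.
  by rewrite gt_max m's hil // mem_head.
move=> j; rewrite inE le_max => /predU1P[->|/hm' ->//].
by rewrite lexx orbT.
Qed.

Lemma esum_finite_gt I a (x : R) :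
  (forall i, I i -> 0 <= a i) -> (x%:E < \esum_(i in I) (a i)%:E)%E ->
  exists il, [/\ uniq il, forall i, i \in il -> I i & x < \sum_(i <- il) a i].
Proof.
move=> a0 /ereal_sup_gt[_ [F [finF FI] <-]].
rewrite fsbig_finite //= sumEFin lte_fin => h.
exists (finmap.enum_fset (fset_set F)); split => //; first exact: finmap.fset_uniq.
by move=> i iF; apply/FI/set_mem; rewrite -in_fset_set.
Qed.

(* The sizes of the family stay below some m < s, so that a finite subfamily may
   miss a fixed fraction of s - m. *)
Lemma esum_finite_cover I a (s : R) : 0 < s ->
  (forall i, I i -> 0 < a i < s) ->
  ((s ^+ 2)%:E <= \esum_(i in I) (a i ^+ 2)%:E)%E ->
  exists il m, [/\ uniq il, forall i, i \in il -> I i,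
    forall i, i \in il -> a i <= m, 0 <= m < s &
    s ^+ 2 - (s - m) / 100 <= \sum_(i <- il) a i ^+ 2].
Proof.
move=> s0 aI hS; have a2 i : I i -> 0 <= a i ^+ 2 by rewrite sqr_ge0.
have [[il [uil ilI big]]|small] := pselect (exists il, [/\ uniq il,
    forall i, i \in il -> I i & s ^+ 2 <= \sum_(i <- il) a i ^+ 2]).
  have [|m [m0 ms hm]] := @bounded_away il a s 0 s0.
    by move=> i /ilI /aI/andP[].
  by exists il, m; split; rewrite ?m0 //; lra.
have lt_esum y : 0 < y -> ((s ^+ 2 - y)%:E < \esum_(i in I) (a i ^+ 2)%:E)%E.
  by move=> y0; apply: lt_le_trans hS; rewrite lte_fin; lra.
have s20 : 0 < s ^+ 2 / 2 by rewrite divr_gt0 ?exprn_gt0.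
(* Finitely many squares already exceed half of [s ^+ 2]. As (3 / 4)^2 > 1 / 2, one further side
   above [3 / 4 * s] would give a finite subfamily reaching [s ^+ 2]; so the bound [m] found on
   [il0] holds for the whole family. *)
have [il0 [uil0 ilI0 h0]] := esum_finite_gt a2 (lt_esum _ s20).
have [||m [sm ms hm]] := @bounded_away il0 a s (3 / 4 * s).
- by lra.
- by move=> i /ilI0 /aI/andP[].
have aIm i : I i -> a i <= m.
  move=> Ii; have [iil|iil] := boolP (i \in il0); first exact: hm.
  rewrite leNgt; apply/negP => mai; apply: small; exists (i :: il0); split.
  - by rewrite /= iil.
  - by move=> j; rewrite inE => /predU1P[->|/ilI0].
  - have /andP[ai0 _] := aI _ Ii; rewrite big_cons.
    have : (3 / 4 * s) ^+ 2 <= a i ^+ 2.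
      by rewrite ler_sqr ?nnegrE; lra.
    have : (3 / 4 * s) ^+ 2 = 9 / 16 * s ^+ 2 by lra.
    by lra.
have h100 : 0 < (s - m) / 100 by lra.
have [il [uil ilI h]] := esum_finite_gt a2 (lt_esum _ h100).
exists il, m; split => //; [by move=> i /ilI /aIm|by lra|].
exact: ltW.
Qed.

Lemma covers_box_of_esum k H I a : 0 <= k <= 1 / 2 -> 10 / 9 <= H <= 7 / 6 ->
  (forall i, I i -> 0 < a i) ->
  (((1 + H) ^+ 2)%:E <= \esum_(i in I) (a i ^+ 2)%:E)%E ->
  exists il, [/\ uniq il, forall i, i \in il -> I i &
    covers [seq a i | i <- il] (skew_box k H)].
Proof.
move=> hk hH a0 hS; have /andP[k0 k1] := hk; have /andP[H0 H1] := hH.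
have [[i Ii ai]|small] := pselect (exists2 i, I i & 1 + H <= a i).
  exists [:: i]; split => //; first by move=> j; rewrite inE => /eqP ->.
  (* The left edge of this single tile passes through the top left vertex of the box. *)
  apply: (@covers1 _ true _ (- k * H, 0)) => -[u v] /and4P[/= v0 vH ku uk].
  have : k * v <= k * H by apply: ler_wpM2l.
  have : 0 <= (1 - k) * (H - v) by apply: mulr_ge0; lra.
  by move=> *; rewrite /tile /=; apply/and3P; split; lra.
have aI i : I i -> 0 < a i < 1 + H.
  move=> Ii; rewrite a0 //= ltNge; apply/negP => ai; apply: small; by exists i.
have s0 : 0 < 1 + H by lra.
have [il [m [uil ilI ilm /andP[m0 ms] hil]]] := esum_finite_cover s0 aI hS.
pose il' := sort (fun i j => a i >= a j) il.
have mem' i : (i \in il') = (i \in il) by rewrite mem_sort.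
exists il'; split; first by rewrite sort_uniq.
  by move=> i; rewrite mem' => /ilI.
apply: covers_skew_box => //.
- rewrite sorted_map; apply: sort_sorted => i j; exact: le_total.
- by apply/allP => x /mapP[i ii ->]; apply/aI/ilI; rewrite -mem'.
- rewrite big_map (perm_big il) ?perm_sort //=; apply: le_trans hil.
  (* The first entry, or the default 0 of an empty list, is at most [m], so the slack expressed by
     [m] suffices. *)
  case: il' mem' => [|i il'] mem' /=; last first.
    by have := ilm i; rewrite -mem' mem_head => /(_ isT); lra.
  by lra.
Qed.
End FiniteSubfamilies.

(** * Parallel coverings *)

Section Assembly.
Variable R : realType.
Implicit Types (x u e f v : R * R) (P T : set (R * R)) (I : set nat).

Lemma area_homothetic k v a e f l : k != 0 -> 0 < l -> equi l e f ->
  area (homothety k v @` tri a e f) = (Num.sqrt 3 / 4 * (`|k| * l) ^+ 2)%:E.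
Proof.
move=> k0 l0 [ee ff ef]; have s3 : 0 < Num.sqrt (3 : R) by rewrite sqrtr_gt0.
have s32 : Num.sqrt (3 : R) ^+ 2 = 3 by rewrite sqr_sqrtr.
rewrite affine_tri; last exact: affine_homothety.
set g := homothety k v (a + e) - _; set h := homothety k v (a + f) - _.
have dE : det g h = k ^+ 2 * det e f.
  by rewrite /g /h /homothety /det /= /GRing.scale /=; ring.
have efE : `|det e f| = Num.sqrt 3 / 2 * l ^+ 2.
  apply/eqP; rewrite -(@eqrXn2 _ 2) ?normr_ge0 //; last first.
    by rewrite mulr_ge0 ?divr_ge0 ?sqr_ge0 // ltW.
  rewrite real_normK ?num_real // det_sqr ee ff ef !exprMn s32.
  by apply/eqP; lra.
have D0 : det g h != 0.
  by rewrite dE mulf_neq0 ?expf_neq0 // -normr_gt0 efE !mulr_gt0 ?invr_gt0 ?exprn_gt0.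
rewrite area_tri // dE normrM efE normrX exprMn; congr EFin; lra.
Qed.

Lemma det_equi1 e f : equi 1 e f -> `|det e f| = Num.sqrt 3 / 2.
Proof.
move=> [ee ff ef]; have s3 : 0 < Num.sqrt (3 : R) by rewrite sqrtr_gt0.
have s32 : Num.sqrt (3 : R) ^+ 2 = 3 by rewrite sqr_sqrtr.
apply/eqP; rewrite -(@eqrXn2 _ 2) ?normr_ge0 //.
rewrite real_normK ?num_real // det_sqr ee ff ef !exprMn s32.
by apply/eqP; lra.
Qed.

Lemma area_frame A e f k H : 0 < H -> equi 1 e f ->
  area (pgram A e (H *: f - (k * H) *: e)) = (H * (Num.sqrt 3 / 2))%:E.
Proof.
move=> H0 ef; have s3 : 0 < Num.sqrt (3 : R) by rewrite sqrtr_gt0.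
have dE : det e (H *: f - (k * H) *: e) = H * det e f.
  by rewrite /det /= /GRing.scale /=; ring.
have D0 : det e (H *: f - (k * H) *: e) != 0.
  by rewrite dE mulf_neq0 //; [rewrite gt_eqF|rewrite -normr_gt0 det_equi1 // divr_gt0].
by rewrite area_pgram // dE normrM (det_equi1 ef) gtr0_norm.
Qed.

(** Downward tiles are the copies of negative ratio. *)
Lemma tile_homothetic (up : bool) (k l : R) (a A e f : R * R) (c p : R * R) :
  k != 0 -> 0 < l -> tile up (`|k| * l) c p ->
  let k' := if up then `|k| else - `|k| in
  (homothety k' (A + c.1 *: e + c.2 *: f - k' *: a) @` tri a (l *: e) (l *: f))
    (A + p.1 *: e + p.2 *: f).
Proof.
move=> k0 l0 tp k'; have nk0 : 0 < `|k| by rewrite normr_gt0.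
have kl0 : 0 < `|k| * l by rewrite mulr_gt0.
pose r := if up then `|k| * l else - (`|k| * l).
have rE : r = k' * l by rewrite /r /k'; case: up {tp k' r} => //; rewrite mulNr.
have r0 : r != 0 by rewrite /r; case: (up); rewrite ?oppr_eq0 gt_eqF.
pose s := (p.1 - c.1) / r; pose t := (p.2 - c.2) / r.
exists (a + s *: (l *: e) + t *: (l *: f)); last first.
  have sE : s * r = p.1 - c.1 by rewrite divfK.
  have tE : t * r = p.2 - c.2 by rewrite divfK.
  have pE1 : p.1 = c.1 + s * (k' * l) by rewrite -rE sE; lra.
  have pE2 : p.2 = c.2 + t * (k' * l) by rewrite -rE tE; lra.
  rewrite /homothety; clearbody s t.
  by apply: pt_eq; rewrite /= /GRing.scale /= pE1 pE2; ring.
exists s, t; rewrite /s /t /r; move: tp; rewrite /tile; case: (up).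
  move=> /and3P[h1 h2 h3]; split => //.
  - by apply: divr_ge0; lra.
  - by apply: divr_ge0; lra.
  - by rewrite -mulrDl ler_pdivrMr // mul1r; lra.
move=> /and3P[h1 h2 h3]; rewrite invrN !mulrN -!mulNr !opprB; split => //.
- by apply: divr_ge0; lra.
- by apply: divr_ge0; lra.
- by rewrite -mulrDl ler_pdivrMr // mul1r; lra.
Qed.

Lemma esumZ_le I (c : R) (F : nat -> R) : 0 <= c -> (forall i, 0 <= F i) ->
  (\esum_(i in I) (c * F i)%:E <= c%:E * \esum_(i in I) (F i)%:E)%E.
Proof.
move=> c0 F0; apply: ge_ereal_sup => _ [X IX <-].
rewrite -[X in (X <= _)%E](_ : (c%:E * \sum_(i \in X) (F i)%:E = _)%E).
  by apply: lee_wpmul2l; rewrite ?lee_fin //; apply: ereal_sup_ubound; exists X.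
by rewrite ge0_mule_fsumr // => i; rewrite lee_fin.
Qed.

Lemma frame_covered alpha A e f (a : R * R) (l k : R) I C P T :
  let H := rheight alpha in
  0 <= k <= 1 / 2 -> 10 / 9 <= H <= 7 / 6 -> 0 < l -> equi 1 e f ->
  P = pgram A e (H *: f - (k * H) *: e) -> T = tri a (l *: e) (l *: f) ->
  (exists p q r s : R * R,
       [/\ is_side P p q, is_side T r s & parallel (s - r) (q - p)]) ->
  (forall n, I n -> homothetic_copy T (C n)) ->
  ((Num.sqrt 3 / 4 * (1 + H) ^+ 2)%:E <= total_area I C)%E ->
  permits_parallel_covering I C P.
Proof.
move=> H hk hH l0 ef PE TE [p [q [r [s [sP sT par]]]]] hC hS.
have s3 : 0 < Num.sqrt (3 : R) / 4 by rewrite divr_gt0 ?sqrtr_gt0.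
have /choice[kv kvP] : forall n, exists kv : R * (R * R),
    I n -> kv.1 != 0 /\ C n = homothety kv.1 kv.2 @` T.
  move=> n; have [In|nIn] := pselect (I n); last by exists (1, 0).
  by have [k1 [v [k10 CE]]] := hC n In; exists (k1, v).
pose b n := `|(kv n).1| * l.
have ef2 := equi_scale l ef; rewrite mulr1 in ef2.
have areaC n : I n -> area (C n) = (Num.sqrt 3 / 4 * b n ^+ 2)%:E.
  by move=> In; have [k0 ->] := kvP n In; rewrite TE (area_homothetic _ _ k0 l0 ef2).
have hb n : I n -> 0 < b n.
  by move=> In; have [k0 _] := kvP n In; rewrite mulr_gt0 ?normr_gt0.
have hS2 : (((1 + H) ^+ 2)%:E <= \esum_(i in I) (b i ^+ 2)%:E)%E.
  rewrite -(@lee_pmul2l _ (Num.sqrt 3 / 4)%:E) ?lte_fin // -EFinM.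
  apply: le_trans hS _; rewrite /total_area (eq_esum areaC).
  by apply: esumZ_le => [|i]; [exact: ltW|rewrite sqr_ge0].
have [il [uil ilI cov]] := covers_box_of_esum hk hH hb hS2.
have [up [c upc]] := covers_placement cov uil.
pose k' n : R := if up n then `|(kv n).1| else - `|(kv n).1|.
pose v' n := A + (c n).1 *: e + (c n).2 *: f - k' n *: a.
have k'E n : `|k' n| = `|(kv n).1|.
  by rewrite /k'; case: (up n); rewrite ?normrN normr_id.
(* The required ratio differs from the given one at most in sign, so a translation or a half-turn
   does it. *)
have /choice[g gP] : forall n, exists g, rigid_motion g /\
    forall x, g (homothety (kv n).1 (kv n).2 x) = homothety (k' n) (v' n) x.
  by move=> n; have [g ? ?] := rigid_motion_hom (kv n).2 (v' n) (k'E n); exists g.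
have gC n : I n -> g n @` C n = homothety (k' n) (v' n) @` T.
  move=> In; have [_ ->] := kvP n In; have [_ gE] := gP n.
  apply/seteqP; split => [_ [_ [x Tx <-] <-]|_ [x Tx <-]].
    by rewrite gE; exists x.
  by rewrite -gE; exists (homothety (kv n).1 (kv n).2 x) => //; exists x.
exists g; split.
- by move=> n _; have [] := gP n.
- rewrite PE => _ [s1 [t1 [/andP[s10 s11] /andP[t10 t11] ->]]].
  have H0 : 0 <= H by lra.
  have [|n nil tn] := upc (s1 - k * (t1 * H), t1 * H).
    have h1 : 0 <= t1 * H by apply: mulr_ge0.
    have h2 : t1 * H <= 1 * H by apply: ler_wpM2r.
    by apply/and4P; split => /=; lra.
  have In := ilI n nil; have [k0 _] := kvP n In; exists n => //.
  rewrite gC // TE.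
  rewrite [X in (homothety _ _ @` _) X](_ : _ =
     A + (s1 - k * (t1 * H)) *: e + (t1 * H) *: f).
    exact: (@tile_homothetic _ _ _ a A e f _ _ k0 l0 tn).
  by apply: pt_eq; rewrite /= /GRing.scale /=; ring.
(* Every copy, also one not selected in [il], is placed as a homothetic image of [T], so the given
   side of [T] yields its parallel side. *)
- exists p, q; split => // n In; rewrite gC //.
  exists (homothety (k' n) (v' n) r), (homothety (k' n) (v' n) s); split.
    apply: is_side_homothety => //; have [k0 _] := kvP n In.
    by rewrite -normr_gt0 k'E normr_gt0.
  rewrite /parallel /homothety /= /GRing.scale /=.
  transitivity (k' n * ((s - r).1 * (q - p).2)); first by rewrite /=; ring.
  by rewrite par /=; ring.
Qed.


(** * The lower bound on the covering factor *)

Lemma is_side_neq0 P (p q : R * R) : is_side P p q -> q - p <> 0.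
Proof. by case=> pq _ /eqP; rewrite subr_eq0 => /eqP/esym. Qed.

(** The motion may turn the triangle, but the image is equilateral of the same side; it is
    relabelled so that its first edge vector follows the side parallel to the rhombus. *)
Lemma single_triangle_size alpha (l : R) (a e f : R * R) g P :
  0 <= rheight alpha -> 0 < l -> equi l e f -> rhombus 1 alpha P ->
  rigid_motion g -> P `<=` g @` tri a e f ->
  (exists p q r s : R * R, [/\ is_side P p q, is_side (g @` tri a e f) r s &
     parallel (s - r) (q - p)]) ->
  1 + rheight alpha <= l.
Proof.
move=> H0 l0 [ee ff ef] hP /rigid_motionP[ag dg] sub [p [q [r [s [sP sT par]]]]].
rewrite affine_tri // in sub sT.
have ef' : equi l (g (a + e) - g a) (g (a + f) - g a).
  have E (b : R * R) : a + b - a = b by rewrite addrAC subrr add0r.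
  apply: equiP; rewrite ?dg ?E //.
  rewrite (_ : _ - _ - _ = g (a + f) - g (a + e)); last first.
    by apply: pt_eq; rewrite /=; ring.
  rewrite dg; move: ee ff ef; rewrite /dot /=; lra.
have [a' [e' [f' [ef2 TE parT]]]] := tri_side ef' sT.
have [A [u [v [uu vv uv PE parP]]]] := rhombus_side hP sP.
apply: (@tri_contains_pgram _ alpha a' e' f' l A u v) => //.
- by rewrite uv.
- apply: (parallel_trans (is_side_neq0 sP)) parP.
  exact: (parallel_trans (is_side_neq0 sT)).
- by rewrite -PE -TE.
Qed.
End Assembly.

Theorem theorem3p3 (R : realType) (alpha : R) (P T : set (R * R))
    (halpha : 5 * pi / 12 < alpha <= pi / 2)
    (hP : rhombus 1 alpha P)
    (hT : equilateral_triangle T)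
    (hbase : exists p q r s : R * R,
       [/\ is_side P p q, is_side T r s & parallel (s - r) (q - p)]) :
  (forall (I : set nat) (C : nat -> set (R * R)),
     (forall n, I n -> homothetic_copy T (C n)) ->
     ((Num.sqrt 3 / 4 * (1 + 2 * Num.sqrt 3 / 3 * sin alpha) ^+ 2)%:E
        <= total_area I C)%E ->
     permits_parallel_covering I C P) /\
  is_rho P T
    (Num.sqrt 3 * (Num.sqrt 3 + 2 * sin alpha) ^+ 2 / (12 * sin alpha)).
Proof.
have [A [k [e [f [a [l [hk l0 ef PE TE]]]]]]] := frame halpha hP hT hbase.
have [s0 c0 hH cH] := angle_bounds halpha; have /andP[H0 H1] := hH.
have s3 : 0 < Num.sqrt (3 : R) by rewrite sqrtr_gt0.
have s32 : Num.sqrt (3 : R) ^+ 2 = 3 by rewrite sqr_sqrtr.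
have covered I C : (forall n, I n -> homothetic_copy T (C n)) ->
    ((Num.sqrt 3 / 4 * (1 + rheight alpha) ^+ 2)%:E <= total_area I C)%E ->
    permits_parallel_covering I C P by exact: frame_covered hk hH l0 ef PE TE hbase.
have areaP : area P = (sin alpha)%:E.
  rewrite PE area_frame //; last by lra.
  congr EFin; rewrite /rheight -[RHS]mul1r.
  transitivity (Num.sqrt 3 ^+ 2 / 3 * sin alpha); first by field.
  by rewrite s32; field.
set r := (X in is_rho _ _ X).
have rE : r * sin alpha = Num.sqrt 3 / 4 * (1 + rheight alpha) ^+ 2.
  have -> : 1 + rheight alpha = Num.sqrt 3 / 3 * (Num.sqrt 3 + 2 * sin alpha).
    transitivity (Num.sqrt 3 ^+ 2 / 3 + Num.sqrt 3 / 3 * (2 * sin alpha)); last by field.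
    by rewrite s32 /rheight; field.
  by rewrite exprMn expr_div_n s32 /r; field; rewrite gt_eqF.
split; first exact: covered.
split.
  split.
    rewrite -(pmulr_lgt0 _ s0) rE; apply: mulr_gt0; first by rewrite divr_gt0.
    by apply: exprn_gt0; lra.
  by move=> I C hC; rewrite areaP -EFinM rE; exact: covered.
(* Minimality is tested on a single copy of [T], of side [b], whose area is exactly [r'] times that
   of [P]; as it covers [P] alone, [b] is at least [1 + rheight alpha]. *)
move=> r' [r'0 hr'].
pose b : R := Num.sqrt (4 * (r' * sin alpha) / Num.sqrt 3).
have b20 : 0 < 4 * (r' * sin alpha) / Num.sqrt 3 by rewrite divr_gt0 // !mulr_gt0.
have b0 : 0 < b by rewrite sqrtr_gt0.
have bE : Num.sqrt 3 / 4 * b ^+ 2 = r' * sin alpha.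
  by rewrite sqr_sqrtr; [field; rewrite gt_eqF|exact: ltW].
have efl := equi_scale l ef; rewrite mulr1 in efl.
have bl0 : 0 < b / l by rewrite divr_gt0.
have blN0 : b / l != 0 by rewrite gt_eqF.
have [//||g [gr sub [p [q [sP sides]]]]] :=
    hr' [set 0%N] (fun=> homothety (b / l) 0 @` T).
- by move=> n _; exists (b / l), 0.
- have aT : area (homothety (b / l) 0 @` T) = (r' * sin alpha)%:E.
    rewrite TE (area_homothetic _ _ blN0 l0 efl) gtr0_norm // divfK ?gt_eqF //.
    by rewrite bE.
  by rewrite areaP -EFinM /total_area esum_set1 aT // lee_fin mulr_ge0 // ltW.
have [r1 [s1 [sT par]]] := sides 0%N erefl.
have size : 1 + rheight alpha <= b.
  have TE' : homothety (b / l) 0 @` T = tri (homothety (b / l) 0 a) (b *: e) (b *: f).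
    rewrite TE affine_tri; last exact: affine_homothety.
    by congr tri; apply: pt_eq; rewrite /homothety /= /GRing.scale /=; field;
      rewrite gt_eqF.
  have efb := equi_scale b ef; rewrite mulr1 in efb.
  apply: (@single_triangle_size _ alpha b (homothety (b / l) 0 a) (b *: e)
    (b *: f) (g 0%N) P) => //.
  - by lra.
  - exact: gr.
  - by move=> x /sub[n /= -> h]; rewrite -TE'.
  - by exists p, q, r1, s1; rewrite -TE'.
rewrite -(ler_pM2r s0) rE -bE ler_pM2l; last by rewrite divr_gt0.
by rewrite ler_sqr ?nnegrE; lra.
Qed.
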